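(* Let $\Omega=\{(q_1,q_2,q_3)\in(\mathbb{R}^2)^3: q_i\neq q_j\text{ for } i\ne j\}$ and let $U:\Omega\to\mathbb{R}$ be the Lennard-Jones three-body potential $$U(q)=\sum_{1\le i<j\le 3}\left(\frac{1}{|q_i-q_j|^{12}}-\frac{2}{|q_i-q_j|^{6}}\right).$$ Put $\alpha=2\pi/3$, $\beta=4\pi/3$ and $$q_{04}=\tfrac{1}{\sqrt3}(1,0,\cos\alpha,\sin\alpha,\cos\beta,\sin\beta),\qquad q_{05}=\tfrac{1}{\sqrt3}(1,0,\cos\beta,\sin\beta,\cos\alpha,\sin\alpha).$$ Let $SO(2)$ act diagonally on $(\mathbb{R}^2)^3$. Then for each $p\in\{q_{04},q_{05}\}$, each $T_0\in\{\pi/(3\sqrt3),\ \pi/(3\sqrt6)\}$, every open neighbourhood $V$ of the orbit $SO(2)(p)$ in $\Omega$ and every $\delta>0$, there exists a non-stationary periodic solution $q(t)$ of $\ddot q(t)=-\nabla U(q(t))$ whose trajectory is contained in $V$ and whose minimal period $T$ satisfies $|T-T_0|<\delta$.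
   Context: Vectors in $\mathbb{R}^6$ are identified with triples $(q_1,q_2,q_3)$ of vectors in $\mathbb{R}^2$ by taking consecutive pairs of coordinates. The diagonal action is $\gamma(q_1,q_2,q_3)=(\gamma q_1,\gamma q_2,\gamma q_3)$, and $SO(2)(p)$ is the orbit of $p$. $|\cdot|$ is the Euclidean norm. *)

(* Defs.v *)
From mathcomp Require Import all_boot all_order all_algebra.
From mathcomp Require Import all_classical all_reals all_analysis.

Set Implicit Arguments.
Unset Strict Implicit.
Unset Printing Implicit Defensive.

Import Order.TTheory GRing.Theory Num.Theory.
Import numFieldNormedType.Exports.

Local Open Scope classical_set_scope.
Local Open Scope ring_scope.

(* The norm [`|x|] of the library on matrices is the sup norm. *)
Definition enorm (R : realType) (n : nat) (v : 'rV[R]_n) : R :=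
  Num.sqrt (\sum_(k < n) v ord0 k ^+ 2).

(* A configuration is a vector of R^6; the position of particle [i] is made of
   its coordinates [2 i] and [2 i + 1] (indices start at 0). *)
Definition particle (R : realType) (i : 'I_3) (q : 'rV[R]_6) : 'rV[R]_2 :=
  \row_(k < 2) q ord0 (inord (2 * i + k)).

Definition Omega (R : realType) : set 'rV[R]_6 :=
  [set q | forall i j : 'I_3, i != j -> particle i q != particle j q].

(* Total on R^6; only its values on the open set [Omega] are meaningful, since
   outside [Omega] the inverse of a zero distance is 0. *)
Definition lennard_jones (R : realType) (q : 'rV[R]_6) : R :=
  \sum_(i < 3) \sum_(j < 3 | (i < j)%N)
    (1 / enorm (particle i q - particle j q) ^+ 12
     - 2 / enorm (particle i q - particle j q) ^+ 6).

Definition gradient (R : realType) (n : nat) (f : 'rV[R]_n.+1 -> R)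
    (x : 'rV[R]_n.+1) : 'rV[R]_n.+1 :=
  \row_(k < n.+1) 'D_(delta_mx ord0 k) f x.

Definition SO2 (R : realType) : set 'M[R]_2 :=
  [set g | g *m g^T = 1%:M /\ \det g = 1].

(* [g] acts on each particle as on a column vector. *)
Definition diag_act (R : realType) (g : 'M[R]_2) (q : 'rV[R]_6) : 'rV[R]_6 :=
  \row_(k < 6)
    (g *m (particle (inord (k %/ 2)) q)^T) (inord (k %% 2)) ord0.

Definition SO2_orbit (R : realType) (p : 'rV[R]_6) : set 'rV[R]_6 :=
  [set diag_act g p | g in @SO2 R].

Definition q04 (R : realType) : 'rV[R]_6 :=
  let a : R := 2 * pi / 3 in
  let b : R := 4 * pi / 3 in
  (Num.sqrt 3)^-1 *:
    \row_(k < 6) [:: 1; 0; cos a; sin a; cos b; sin b]`_k.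

Definition q05 (R : realType) : 'rV[R]_6 :=
  let a : R := 2 * pi / 3 in
  let b : R := 4 * pi / 3 in
  (Num.sqrt 3)^-1 *:
    \row_(k < 6) [:: 1; 0; cos b; sin b; cos a; sin a]`_k.

Definition newton_solution (R : realType) (q : R -> 'rV[R]_6) : Prop :=
  forall t : R,
    [/\ @Omega R (q t), derivable q t 1, derivable (derive1 q) t 1 &
        derive1 (derive1 q) t = - gradient (@lennard_jones R) (q t)].

Definition non_stationary (R : realType) (n : nat) (q : R -> 'rV[R]_n) : Prop :=
  ~ (exists c : 'rV[R]_n, forall t : R, q t = c).

Definition minimal_period (R : realType) (n : nat) (q : R -> 'rV[R]_n) (T : R)
    : Prop :=
  [/\ 0 < T, periodic q T & forall S : R, 0 < S -> periodic q S -> T <= S].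

(* Main.v *)
Require Import Defs.
From mathcomp Require Import all_boot all_order all_algebra.
From mathcomp Require Import all_classical all_reals all_analysis.
From mathcomp Require Import ring lra.

Set Implicit Arguments.
Unset Strict Implicit.
Unset Printing Implicit Defensive.

Import Order.TTheory GRing.Theory Num.Theory.
Import numFieldNormedType.Exports.

Local Open Scope classical_set_scope.
Local Open Scope ring_scope.

(** Near an equilateral triangle of side 1 the potential has, apart from the
    directions of translations and of the rotation, the eigenvalue 216 on
    homothetic deformations and 108 on a plane of shape deformations.  The two
    periods [T0] are the linear periods [2 pi / sqrt 108] and
    [2 pi / sqrt 216], and the claim is that both linear oscillations continue
    to nonlinear periodic motions of small amplitude.

    Triangles that are symmetric about the first axis and centred at the origin
    form an invariant set with two degrees of freedom [X] and [Y]
    ([gradient_isosceles]); on it each of the two eigenvalues is simple.  The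
    motions stay near [p] itself, and since [p] lies on its own orbit this is
    enough; the two orientations [q04] and [q05] differ by the sign of [Y].

    On this set the normal modes satisfy [u'' = - 216 u + N1(u, v)],
    [v'' = - 108 v + N2(u, v)], where [N1] and [N2] vanish to first order.  As
    neither [sqrt 2] nor [1 / sqrt 2] is an integer, Lyapunov's center theorem
    ([brake_orbits]) applies to either mode.  It is proved here for motions that
    are at rest at time 0 and again after half a period, hence even and periodic
    ([reflect_even_periodic]).  Time is rescaled so that the period is [2 pi].
    The nonresonant mode [U] is the unique even [2 pi]-periodic response to its
    force ([response]), of norm controlled by [1 / sin (k pi)] with [k] the ratio
    of the frequencies; the resonant mode is [V = cos + ...], and the force on it
    has to be orthogonal to [cos], which determines the change of the period
    ([detuning]).  After division by a small amplitude the nonlinear terms have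
    a small Lipschitz constant, so that detuning, [U] and [V] together are the
    fixed point of a contraction for the uniform norm ([uniform_fixed_point],
    [update_fixed_point]).  Since [V] is uniformly close to [cos], the minimal
    period is exactly [2 pi] in rescaled time ([cos_like_min_period]).

    For the smallness of the Lipschitz constants only strict differentiability of
    the accelerations at the equilibrium matters; it is propagated by a product,
    an inverse and a power rule. *)

(** * Primitives of continuous functions *)

Lemma is_derive_continuous (R : realType) (f : R -> R) (x df : R) :
  is_derive x 1 f df -> {for x, continuous f}.
Proof.
by move=> fd; apply/differentiable_continuous/derivable1_diffP; case: fd.
Qed.

Lemma mean_value (R : realType) (f df : R -> R) (a b : R) : a < b ->
  (forall x, a <= x <= b -> is_derive x 1 f (df x)) ->
  exists2 c, a < c < b & f b - f a = df c * (b - a).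
Proof.
move=> ab fd; have [| |c] := @MVT R f df a b ab.
- by move=> x /itvP xab; apply: fd; rewrite !xab.
- apply: derivable_within_continuous => x /itvP xab.
  by case: (fd x) => //; rewrite !xab.
- by move=> /itvP cab ->; exists c => //; rewrite !cab.
Qed.

(** The integral over a set carries no orientation, so the primitive vanishing
    at 0 is assembled from its two halves; the base point -1 leaves 0 in the
    interior of the domain of each half, where they can be compared. *)
Definition half_prim (R : realType) (f : R -> R) (x : R) : R :=
  (\int[lebesgue_measure]_(t in `[-1, x]) f t -
   \int[lebesgue_measure]_(t in `[-1, 0]) f t)%R.

Definition prim (R : realType) (f : R -> R) (x : R) : R :=
  if 0 <= x then half_prim f x else - half_prim (fun t => f (- t)) (- x).

Lemma half_prim_derive (R : realType) (f : R -> R) (x : R) :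
  continuous f -> -1 < x -> is_derive x 1 (half_prim f) (f x).
Proof.
move=> fc x1.
have fi : lebesgue_measure.-integrable `[(-1), x + 1] (EFin \o f).
  apply: continuous_compact_integrable; first exact: segment_compact.
  exact: continuous_subspaceT.
have xx1 : x < x + 1 by rewrite ltrDl.
have [Fd F1] := continuous_FTC1_closed xx1 fi x1 (fc x).
pose F y := \int[lebesgue_measure]_(t in `[-1, y]) f t.
have F' : is_derive x 1 F (f x) by rewrite -F1 derive1E; apply/derivableP.
by rewrite /half_prim -/(F _); apply: is_derive_eq; rewrite subr0.
Qed.

Lemma prim_derive (R : realType) (f : R -> R) (x : R) :
  continuous f -> is_derive x 1 (prim f) (f x).
Proof.
move=> fc; pose g t := f (- t).
have gc : continuous g.
  by move=> t; apply: continuous_comp; [exact: opp_continuous|exact: fc].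
have left_derive (y : R) : y < 1 ->
    is_derive y 1 (fun s => - half_prim g (- s)) (f y).
  move=> y1; have gd : is_derive (- y) 1 (half_prim g) (g (- y)).
    by apply: half_prim_derive => //; lra.
  by apply: is_derive_eq; rewrite /g opprK; ring.
have [x0|x0|->] := ltgtP x 0.
- apply: near_eq_is_derive; last by apply: left_derive; lra.
  near=> y; rewrite /prim ifF //; apply/negbTE; rewrite -ltNge.
  by near: y; exact: lt_nbhsl.
- apply: near_eq_is_derive; last by apply: half_prim_derive => //; lra.
  near=> y; rewrite /prim ifT //; apply: ltW.
  by near: y; exact: lt_nbhsr.
- apply: near_eq_is_derive; last by apply: half_prim_derive => //; lra.
  near=> y; rewrite /prim; case: leP => // y0.
  have y1 : -1 < y by near: y; apply: lt_nbhsr; lra.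
  (* both candidates have derivative [f] on [y, 0] and vanish at 0 *)
  pose h s := half_prim f s - - half_prim g (- s).
  have [|c _] := @mean_value R h (fun=> 0) y 0 y0.
    move=> s /andP[ys s0].
    have ? : is_derive s 1 (half_prim f) (f s).
      by apply: half_prim_derive => //; lra.
    have ? := left_derive s ltac:(lra).
    by apply: is_derive_eq; rewrite subrr.
  by rewrite /h /half_prim oppr0 !subrr; lra.
Unshelve. all: by end_near. Qed.

Lemma prim0 (R : realType) (f : R -> R) : prim f 0 = 0.
Proof. by rewrite /prim lexx /half_prim subrr. Qed.

(** * Forced harmonic oscillators *)

Lemma eq_derive (R : realType) (F G f : R -> R) (a : R) :
  (forall x : R, is_derive x 1 F (f x)) -> (forall x : R, is_derive x 1 G (f x)) ->
  F a = G a -> F =1 G.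
Proof.
move=> dF dG FGa x; apply/eqP; rewrite -subr_eq0; apply/eqP.
transitivity (F a - G a); last by rewrite FGa subrr.
apply: (@is_derive_0_is_cst R (fun s => F s - G s)) => s.
by have ? := dF s; have ? := dG s; apply: is_derive_eq; rewrite subrr.
Qed.

Lemma primE (R : realType) (F f : R -> R) : continuous f ->
  (forall x : R, is_derive x 1 F (f x)) -> F 0 = 0 -> prim f =1 F.
Proof.
move=> fc dF F0; apply: (@eq_derive _ _ _ f 0) => //; last by rewrite prim0 F0.
by move=> x; exact: prim_derive.
Qed.

Lemma norm_le_derive (R : realType) (F f : R -> R) (e s : R) :
  (forall x : R, is_derive x 1 F (f x)) -> (forall x, `|f x| <= e) ->
  F 0 = 0 -> 0 <= s -> `|F s| <= e * s.
Proof.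
move=> dF fe F0; rewrite le_eqVlt => /predU1P[<-|s0].
  by rewrite F0 normr0 mulr0.
have [c _] := mean_value s0 (fun x _ => dF x).
by rewrite F0 !subr0 => ->; rewrite normrM (gtr0_norm s0) ler_pM2r.
Qed.

Lemma prim_lip (R : realType) (f g : R -> R) (e s : R) :
  continuous f -> continuous g -> (forall x, `|f x - g x| <= e) ->
  0 <= s -> `|prim f s - prim g s| <= e * s.
Proof.
move=> fc gc fge.
apply: (@norm_le_derive _ (fun x => prim f x - prim g x)) fge _.
  move=> x; have ? := prim_derive x fc; have ? := prim_derive x gc.
  exact: is_derive_eq.
by rewrite !prim0 subrr.
Qed.

(** Variation of constants: the solution of [u'' + k^2 u = f] starting at rest
    at the origin, and its derivative. *)
Definition osc (R : realType) (k : R) (f : R -> R) (s : R) : R :=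
  k^-1 * (sin (k * s) * prim (fun t => cos (k * t) * f t) s
          - cos (k * s) * prim (fun t => sin (k * t) * f t) s).

Definition oscD (R : realType) (k : R) (f : R -> R) (s : R) : R :=
  cos (k * s) * prim (fun t => cos (k * t) * f t) s
  + sin (k * s) * prim (fun t => sin (k * t) * f t) s.

Section oscillator.
Context {R : realType} (k : R) (k0 : 0 < k).
Implicit Types (f g : R -> R) (e s : R).

Lemma continuous_cosM : continuous (fun t => cos (k * t)).
Proof.
move=> t; apply: (@is_derive_continuous _ _ _ (- k * sin (k * t))).
by apply: is_derive_eq; rewrite /GRing.scale/=; ring.
Qed.

Lemma continuous_sinM : continuous (fun t => sin (k * t)).
Proof.
move=> t; apply: (@is_derive_continuous _ _ _ (k * cos (k * t))).
by apply: is_derive_eq; rewrite /GRing.scale/=; ring.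
Qed.

Lemma continuous_cosMf f : continuous f ->
  continuous (fun t => cos (k * t) * f t).
Proof. by move=> fc t; apply: cvgM; [exact: continuous_cosM|exact: fc]. Qed.

Lemma continuous_sinMf f : continuous f ->
  continuous (fun t => sin (k * t) * f t).
Proof. by move=> fc t; apply: cvgM; [exact: continuous_sinM|exact: fc]. Qed.

Lemma osc_derive f (s : R) : continuous f -> is_derive s 1 (osc k f) (oscD k f s).
Proof.
move=> fc; have ? := prim_derive s (continuous_cosMf fc).
have ? := prim_derive s (continuous_sinMf fc).
apply: is_derive_eq; rewrite /oscD /GRing.scale/=; field; exact: lt0r_neq0.
Qed.

Lemma oscD_derive f (s : R) : continuous f ->
  is_derive s 1 (oscD k f) (f s - k ^+ 2 * osc k f s).
Proof.
move=> fc; have ? := prim_derive s (continuous_cosMf fc).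
have ? := prim_derive s (continuous_sinMf fc).
apply: is_derive_eq; rewrite /osc /GRing.scale/=.
transitivity ((cos (k * s) ^+ 2 + sin (k * s) ^+ 2) * f s - k ^+ 2 *
  (k^-1 * (sin (k * s) * prim (fun t => cos (k * t) * f t) s -
   cos (k * s) * prim (fun t => sin (k * t) * f t) s))); last first.
  by rewrite cos2Dsin2 mul1r.
field; exact: lt0r_neq0.
Qed.

Lemma oscD0 f : oscD k f 0 = 0.
Proof. by rewrite /oscD !prim0 !mulr0 addr0. Qed.

Lemma prim_trig_lip f g e s : continuous f -> continuous g ->
  (forall x, `|f x - g x| <= e) -> 0 <= s <= pi ->
  `|prim (fun t => cos (k * t) * f t) s - prim (fun t => cos (k * t) * g t) s|
     <= pi * e /\
  `|prim (fun t => sin (k * t) * f t) s - prim (fun t => sin (k * t) * g t) s|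
     <= pi * e.
Proof.
move=> fc gc fge /andP[s0 spi].
have e0 : 0 <= e := le_trans (normr_ge0 _) (fge 0).
split; (apply: (@le_trans _ _ (e * s)); last by rewrite mulrC ler_wpM2r).
- apply: prim_lip => //; [exact: continuous_cosMf..|].
  move=> x; rewrite -mulrBr normrM -[e]mul1r.
  by apply: ler_pM => //; exact: cos_max.
- apply: prim_lip => //; [exact: continuous_sinMf..|].
  move=> x; rewrite -mulrBr normrM -[e]mul1r.
  by apply: ler_pM => //; exact: sin_max.
Qed.

Lemma trig_comb_le (c s a b e : R) : `|c| <= 1 -> `|s| <= 1 ->
  `|a| <= e -> `|b| <= e -> `|c * a + s * b| <= 2 * e.
Proof.
move=> c1 s1 ae be; rewrite mulr_natl mulr2n.
apply: (le_trans (ler_normD _ _)); rewrite !normrM.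
by apply: lerD; rewrite -[e]mul1r; apply: ler_pM.
Qed.

Lemma osc_lip f g e s : continuous f -> continuous g ->
  (forall x, `|f x - g x| <= e) -> 0 <= s <= pi ->
  `|osc k f s - osc k g s| <= 2 * pi / k * e.
Proof.
move=> fc gc fge spi; have [C S] := prim_trig_lip fc gc fge spi.
rewrite /osc -mulrBr normrM gtr0_norm ?invr_gt0//.
rewrite [2 * _ / _ * _](_ : _ = k^-1 * (2 * (pi * e))); last by ring.
rewrite ler_pM2l ?invr_gt0//.
set c1 := prim _ _; set c2 := prim _ _; set c3 := prim _ _; set c4 := prim _ _.
rewrite (_ : _ - _ = sin (k * s) * (c1 - c3) + - cos (k * s) * (c2 - c4));
  last by ring.
by apply: trig_comb_le; rewrite ?normrN ?sin_max ?cos_max.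
Qed.

Lemma oscD_lip f g e s : continuous f -> continuous g ->
  (forall x, `|f x - g x| <= e) -> 0 <= s <= pi ->
  `|oscD k f s - oscD k g s| <= 2 * pi * e.
Proof.
move=> fc gc fge spi; have [C S] := prim_trig_lip fc gc fge spi.
rewrite /oscD -mulrA.
set c1 := prim _ _; set c2 := prim _ _; set c3 := prim _ _; set c4 := prim _ _.
rewrite (_ : _ - _ = cos (k * s) * (c1 - c3) + sin (k * s) * (c2 - c4));
  last by ring.
by apply: trig_comb_le; rewrite ?sin_max ?cos_max.
Qed.

(** The energy [w'^2 + k^2 w^2] is conserved. *)
Lemma harmonic_eq0 (w w' : R -> R) (a : R) :
  (forall s : R, is_derive s 1 w (w' s)) ->
  (forall s : R, is_derive s 1 w' (- k ^+ 2 * w s)) ->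
  w a = 0 -> w' a = 0 -> forall s, w s = 0.
Proof.
move=> dw dw' wa w'a s.
have /(@is_derive_0_is_cst _ _ s a) : forall x : R, is_derive x 1
    (fun t => w' t ^+ 2 + k ^+ 2 * w t ^+ 2) 0.
  move=> x; have ? := dw x; have ? := dw' x; apply: is_derive_eq.
  by rewrite /GRing.scale/=; ring.
rewrite wa w'a !expr0n/= mulr0 addr0 => /eqP.
rewrite paddr_eq0 ?sqr_ge0 ?(mulr_ge0 (sqr_ge0 _) (sqr_ge0 _))// => /andP[_].
by rewrite mulf_eq0 !sqrf_eq0 gt_eqF//= => /eqP.
Qed.

Definition even_periodic (f : R -> R) :=
  (forall s, f (- s) = f s) /\ (forall s, f (s + 2 * pi) = f s).

(** A motion at rest at times 0 and [pi] closes up: its even reflection has the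
    same state at 0, and its shift by a full period the same state at [- pi]. *)
Lemma reflect_even_periodic (u u' f : R -> R) :
  (forall s : R, is_derive s 1 u (u' s)) ->
  (forall s : R, is_derive s 1 u' (f s - k ^+ 2 * u s)) ->
  even_periodic f -> u' 0 = 0 -> u' pi = 0 -> even_periodic u.
Proof.
move=> du du' [fe fp] u'0 u'pi.
have dNu (s : R) : is_derive s 1 (fun t => u (- t)) (- u' (- s)).
  have ? := du (- s); apply: is_derive_eq; rewrite /GRing.scale/=; ring.
have dNu' (s : R) : is_derive s 1 (fun t => - u' (- t)) (f s - k ^+ 2 * u (- s)).
  have ? := du' (- s); apply: is_derive_eq; rewrite fe /GRing.scale/=; ring.
have even_u s : u (- s) = u s.
  apply/eqP; rewrite -subr_eq0; apply/eqP; move: s.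
  apply: (@harmonic_eq0 (fun t => u (- t) - u t) (fun t => - u' (- t) - u' t) 0).
  - by move=> s; apply: is_derive_eq; ring.
  - by rewrite oppr0 subrr.
  - by rewrite oppr0 u'0 subr0 oppr0.
split=> // s; apply/eqP; rewrite -subr_eq0; apply/eqP; move: s.
apply: (@harmonic_eq0 (fun t => u (t + 2 * pi) - u t)
  (fun t => u' (t + 2 * pi) - u' t) (- pi)).
- by move=> s; apply: is_derive_eq; rewrite /GRing.scale/=; ring.
- by move=> s; apply: is_derive_eq; rewrite fp /GRing.scale/=; ring.
- by rewrite even_u (_ : - pi + 2 * pi = pi) ?subrr//; ring.
- rewrite (_ : - pi + 2 * pi = pi); last by ring.
  have /funext uN : (fun t => u (- t)) =1 u by [].
  have [_] := dNu pi; rewrite uN; have [_ ->] := du pi.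
  rewrite u'pi => /eqP; rewrite eq_sym oppr_eq0 => /eqP ->.
  by rewrite subrr.
Qed.

(** [0, pi] is a fundamental domain for the reflections at the multiples of
    [pi], so operators need to be estimated there only. *)
Lemma even_periodic_le (f : R -> R) (e : R) : even_periodic f ->
  (forall s, 0 <= s <= pi -> `|f s| <= e) -> forall s, `|f s| <= e.
Proof.
move=> [fe fp] fle s; have pi0 := pi_gt0 R.
have fpn (n : nat) t : f (t + n%:R * (2 * pi)) = f t.
  elim: n => [|n IHn]; first by rewrite mul0r addr0.
  by rewrite -natr1 mulrDl mul1r addrA fp.
have fabs t : f `|t| = f t by case: (ger0P t) => // _; rewrite fe.
rewrite -fabs; set t := `|s|.
have t0 : 0 <= t by exact: normr_ge0.
have P0 : 0 < 2 * pi :> R by rewrite mulr_gt0.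
pose n := Num.truncn (t / (2 * pi)).
have /andP[nt tn] : n%:R <= t / (2 * pi) < n.+1%:R.
  by apply: truncn_itv; rewrite divr_ge0// ltW.
rewrite ler_pdivlMr// in nt; rewrite ltr_pdivrMr// -natr1 mulrDl mul1r in tn.
rewrite -[t](subrK (n%:R * (2 * pi))) fpn.
set r := t - _; have [rpi|rpi] := leP r pi.
  by apply: fle; rewrite rpi andbT subr_ge0.
rewrite -fe -fp; apply: fle; rewrite /r in rpi *; apply/andP; split; lra.
Qed.
End oscillator.

(** * A fixed point principle; the minimal period of functions close to cos *)

Lemma small_halving (R : realType) (c e : R) : 0 < e ->
  exists n : nat, c / 2 ^+ n <= e.
Proof.
move=> e0; have ce : 0 <= `|c| / e by rewrite divr_ge0// ltW.
exists (Num.bound (`|c| / e)); apply: (le_trans (ler_norm _)).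
rewrite normrM [X in _ * X]gtr0_norm ?invr_gt0 ?exprn_gt0//.
rewrite ler_pdivrMr ?exprn_gt0// mulrC -ler_pdivrMr//.
apply: le_trans (ltW (archi_boundP ce)) _.
by rewrite -natrX ler_nat ltnW// ltn_expl.
Qed.

(** Banach's principle for functions on an arbitrary set [X], with uniform
    distances expressed pointwise; allowing any [X] lets one fixed point carry
    several unknown functions and numbers at once.  The limit of the iterates
    [z n] is the supremum of the lower bounds [z n x - r n], where [r n] bounds
    the distance from [z n] to all later iterates. *)
Lemma uniform_fixed_point (R : realType) (X : Type) (S : set (X -> R))
    (Phi : (X -> R) -> X -> R) (z0 : X -> R) (c : R) :
  S z0 -> (forall x, `|Phi z0 x - z0 x| <= c) ->
  (forall z, S z -> S (Phi z)) ->
  (forall (z w : X -> R) (e : R), S z -> S w -> (forall x : X, `|z x - w x| <= e) ->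
    forall x, `|Phi z x - Phi w x| <= e / 2) ->
  (forall z : X -> R, (forall e : R, 0 < e ->
    exists2 w, S w & forall x, `|z x - w x| <= e) -> S z) ->
  exists2 z, S z & Phi z =1 z.
Proof.
move=> Sz0 z0c SPhi contr Sclosed; pose z n := iter n Phi z0.
pose r n : R := 2 * c / 2 ^+ n.
have Sz n : S (z n) by elim: n => //= n; exact: SPhi.
have rge0 n (x : X) : 0 <= r n.
  rewrite divr_ge0 ?exprn_ge0 ?mulr_ge0//.
  exact: le_trans (normr_ge0 _) (z0c x).
have rS n : r n = 2 * r n.+1 by rewrite /r exprS; field; rewrite expf_neq0//.
have step n x : `|z n.+1 x - z n x| <= r n.+1.
  elim: n x => [|n IHn] x.
    by have -> : r 1%N = c; [rewrite /r expr1; field|exact: z0c].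
  have -> : r n.+2 = r n.+1 / 2 by rewrite (rS n.+1); field.
  exact: contr (Sz _) (Sz _) IHn x.
have tail k n x : `|z (n + k)%N x - z n x| <= r n.
  elim: k n => [|k IHk] n.
    by rewrite addn0 subrr normr0 rge0.
  rewrite addnS -addSn -(subrKA (z n.+1 x)).
  apply: le_trans (ler_normD _ _) _.
  by rewrite rS mulr_natl mulr2n lerD.
have tailW n m x : z m x - r m <= z n x + r n.
  have [nm|mn] := leqP n m.
    have := tail (m - n)%N n x; rewrite subnKC// => /ler_normlP[_ h].
    by have := rge0 m x; lra.
  have := tail (n - m)%N m x; rewrite subnKC 1?ltnW// => /ler_normlP[h _].
  by have := rge0 n x; lra.
pose lo x := [set y | exists n, y = z n x - r n].
have lo0 x : lo x !=set0 by exists (z 0%N x - r 0%N), 0%N.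
pose w x := sup (lo x).
have wz n x : `|w x - z n x| <= r n.
  apply/ler_normlP; split.
    have : z n x - r n <= w x; last by lra.
    apply: ub_le_sup; last by exists n.
    by exists (z n x + r n) => _ [m ->]; exact: tailW.
  have : w x <= z n x + r n; last by lra.
  by apply: ge_sup => // _ [m ->]; exact: tailW.
have Sw : S w.
  apply: Sclosed => e e0; have [n rn] := small_halving (2 * c) e0.
  by exists (z n) => // x; exact: le_trans (wz n x) rn.
exists w => // x; apply/eqP; rewrite -subr_eq0 -normr_eq0 eq_le normr_ge0 andbT.
apply/ler_addgt0Pr => e e0; rewrite add0r.
have [n rn] := small_halving (2 * c) e0; apply: le_trans rn.
rewrite -/(r n) -(subrKA (z n.+1 x)); apply: le_trans (ler_normD _ _) _.
have -> : r n = r n / 2 + r n.+1 by rewrite (rS n); field.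
apply: lerD; first exact: contr Sw (Sz n) (wz n) x.
by rewrite distrC; exact: wz.
Qed.

(** A period shorter than [pi] would have a multiple in [[pi/2, pi]], where [cos]
    is nonpositive, so [v] could not return to its value at 0, which is above
    1/2.  A period between [pi] and [2 pi] gives a shorter one by complement. *)
Lemma cos_like_min_period (R : realType) (v : R -> R) (S : R) :
  (forall s, `|v s - cos s| < 1 / 2) -> (forall s, v (s + 2 * pi) = v s) ->
  0 < S -> (forall s, v (s + S) = v s) -> 2 * pi <= S.
Proof.
have pi0 := pi_gt0 R.
move=> vcos vP.
have noshort (d : R) : 0 < d <= pi -> ~ (forall s, v (s + d) = v s).
  move=> /andP[d0 dpi] vd.
  have vdn (n : nat) : v (n%:R * d) = v 0.
    elim: n => [|n IHn]; first by rewrite mul0r.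
    by rewrite -natr1 mulrDl mul1r vd.
  have [n /andP[n1 n2]] : exists n : nat, pi / 2 <= n%:R * d <= pi.
    have [d2|d2] := leP (pi / 2) d; first by exists 1%N; rewrite mul1r d2.
    exists (Num.truncn (pi / d)).
    have /andP[nt tn] : (Num.truncn (pi / d))%:R <= pi / d
        < (Num.truncn (pi / d)).+1%:R.
      by apply: truncn_itv; rewrite divr_ge0// ltW.
    rewrite ler_pdivlMr// in nt; rewrite ltr_pdivrMr// -natr1 mulrDl mul1r in tn.
    by rewrite nt andbT; lra.
  have : cos (n%:R * d) <= 0.
    rewrite -[_ * d](subrK (pi / 2)) cosDpihalf oppr_le0.
    by apply: sin_ge0_pi; lra.
  have := vcos (n%:R * d); have := vcos 0; rewrite vdn cos0.
  move=> /ltr_normlP[? ?] /ltr_normlP[? ?].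
  by lra.
move=> S0 vS; rewrite leNgt; apply/negP => S2.
have [Spi|piS] := leP S pi; first by apply: (noshort S) => //; rewrite S0.
apply: (noshort (2 * pi - S)); first by apply/andP; split; lra.
by move=> s; rewrite -vS -[RHS]vP; congr v; ring.
Qed.

(** * Even periodic responses *)

Lemma norm_mulB_le (R : realType) (a b a' b' A B da db : R) :
  `|a| <= A -> `|b'| <= B -> `|a - a'| <= da -> `|b - b'| <= db ->
  `|a * b - a' * b'| <= A * db + da * B.
Proof.
move=> aA bB ada bdb.
have -> : a * b - a' * b' = a * (b - b') + (a - a') * b' by ring.
by apply: le_trans (ler_normD _ _) _; rewrite !normrM lerD// ler_pM.
Qed.

Lemma even_periodicB (R : realType) (f g : R -> R) :
  even_periodic f -> even_periodic g -> even_periodic (fun s => f s - g s).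
Proof.
by move=> [fe fp] [ge gp]; split=> s; [rewrite fe ge|rewrite fp gp].
Qed.

Lemma even_periodic_cos (R : realType) : even_periodic (@cos R).
Proof. by split=> s; [exact: cosN|rewrite mulr_natl cosD2pi]. Qed.

Lemma prim_zero (R : realType) : prim (fun=> 0 : R) =1 fun=> 0.
Proof. by apply: primE => // x; exact: cst_continuous. Qed.

Lemma osc_zero (R : realType) (k s : R) : osc k (fun=> 0) s = 0.
Proof.
rewrite /osc; under [X in prim X]eq_fun do rewrite mulr0.
under [X in _ - _ * prim X _]eq_fun do rewrite mulr0.
by rewrite prim_zero !mulr0 subrr mulr0.
Qed.

Lemma oscD_zero (R : realType) (k s : R) : oscD k (fun=> 0) s = 0.
Proof.
rewrite /oscD; under [X in prim X]eq_fun do rewrite mulr0.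
under [X in _ + _ * prim X _]eq_fun do rewrite mulr0.
by rewrite prim_zero !mulr0 addr0.
Qed.

Section response.
Context {R : realType} (k : R).
Implicit Types (f g : R -> R) (e s : R).

(** The multiple of [cos (k s)] is chosen so that the motion is again at rest
    at time [pi]. *)
Definition response f (s : R) : R :=
  osc k f s + oscD k f pi / (k * sin (k * pi)) * cos (k * s).

Definition responseD f (s : R) : R :=
  oscD k f s - oscD k f pi / sin (k * pi) * sin (k * s).

Hypothesis k0 : 0 < k.
Hypothesis sink : sin (k * pi) != 0.

Lemma response_derive f (s : R) : continuous f ->
  is_derive s 1 (response f) (responseD f s).
Proof.
move=> fc; have ? := osc_derive k0 s fc.
apply: is_derive_eq; rewrite /responseD /GRing.scale/=; field.
by rewrite sink lt0r_neq0.
Qed.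

Lemma responseD_derive f (s : R) : continuous f ->
  is_derive s 1 (responseD f) (f s - k ^+ 2 * response f s).
Proof.
move=> fc; have ? := oscD_derive k0 s fc.
apply: is_derive_eq; rewrite /response /GRing.scale/=; field.
by rewrite sink lt0r_neq0.
Qed.

Lemma response_even_periodic f : continuous f -> even_periodic f ->
  even_periodic (response f).
Proof.
move=> fc fep; apply: (@reflect_even_periodic _ k k0 _ (responseD f) f).
- by move=> s; exact: response_derive.
- by move=> s; exact: responseD_derive.
- exact: fep.
- by rewrite /responseD oscD0 mulr0 sin0 mulr0 subrr.
- by rewrite /responseD divfK// subrr.
Qed.

Lemma response_lip f g e : continuous f -> continuous g ->
  even_periodic f -> even_periodic g -> (forall x, `|f x - g x| <= e) ->
  forall s, `|response f s - response g s|
    <= (2 * pi / k + 2 * pi / (k * `|sin (k * pi)|)) * e.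
Proof.
move=> fc gc fep gep fge; apply: even_periodic_le.
  by apply: even_periodicB; exact: response_even_periodic.
move=> s spi; rewrite /response.
rewrite [X in `|X|](_ : _ = (osc k f s - osc k g s) +
  (oscD k f pi - oscD k g pi) / (k * sin (k * pi)) * cos (k * s)); last by ring.
apply: le_trans (ler_normD _ _) _.
rewrite [X in _ <= X]mulrDl lerD//; first exact: osc_lip.
rewrite -[X in _ <= X]mulr1 normrM; apply: ler_pM => //; last exact: cos_max.
rewrite normrM normfV normrM (gtr0_norm k0) [X in _ <= X]mulrAC ler_wpM2r//.
  by rewrite invr_ge0 mulr_ge0// ltW.
by apply: oscD_lip => //; rewrite pi_ge0 lexx.
Qed.

End response.

Lemma osc1_even_periodic (R : realType) (f : R -> R) :
  continuous f -> even_periodic f ->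
  prim (fun t => cos (1 * t) * f t) pi = 0 -> even_periodic (osc 1 f).
Proof.
move=> fc fep f0.
apply: (@reflect_even_periodic _ 1 ltr01 _ (oscD 1 f) f).
- by move=> s; exact: osc_derive.
- by move=> s; exact: oscD_derive.
- exact: fep.
- exact: oscD0.
- by rewrite /oscD f0 mulr0 mul1r sinpi mul0r addr0.
Qed.

(** The mean of [cos^2] over a half period is 1/2, so a multiple of [cos] added
    to a force gives its resonant part any prescribed value. *)
Lemma prim_cos_project (R : realType) (g : R -> R) (b : R) : continuous g ->
  prim (fun t => cos (1 * t) * (g t + b * cos t)) pi =
  prim (fun t => cos (1 * t) * g t) pi + b * (pi / 2).
Proof.
move=> gc; have cgc := @continuous_cosMf _ 1 _ gc.
have h : continuous (fun t => g t + b * cos t).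
  move=> t; apply: cvgD; first exact: gc.
  by apply: cvgM; [exact: cvg_cst|exact: continuous_cos].
pose F t := prim (fun t => cos (1 * t) * g t) t +
  b * ((t + sin t * cos t) / 2).
transitivity (F pi); last by rewrite /F sinpi mul0r addr0.
apply: primE.
- exact: continuous_cosMf.
- move=> x; have ? := prim_derive x cgc.
  rewrite /F; apply: is_derive_eq; rewrite /GRing.scale/= mul1r.
  have := cos2Dsin2 x => cs.
  transitivity (cos x * g x +
    b * ((cos x ^+ 2 + sin x ^+ 2) + cos x ^+ 2 - sin x ^+ 2) / 2).
    by rewrite cs; field.
  by field.
- by rewrite /F prim0 sin0 mul0r !addr0 mul0r mulr0 addr0.
Qed.

(** * The forces on the two modes *)

(** Lipschitz with constant [eta] for the maximum norm on a square. *)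
Definition lip_on (R : realType) (r eta : R) (n : R -> R -> R) : Prop :=
  n 0 0 = 0 /\ forall u v u' v' d : R,
    `|u| <= r -> `|v| <= r -> `|u'| <= r -> `|v'| <= r ->
    `|u - u'| <= d -> `|v - v'| <= d -> `|n u v - n u' v'| <= eta * d.

Section contraction.
Context {R : realType} (k theta : R) (n1 n2 : R -> R -> R).
Implicit Types (m e s : R) (U V : R -> R).

(** The rescaled equations are [U'' + k^2 U = forceU] and [V'' + V = forceV]:
    with [mu = theta * m], they are [U'' = (1 - mu) (n1 - k^2 U)] and
    [V'' = (1 - mu) (n2 - V)], where [1 - mu] is the squared ratio of the linear
    frequency to the true one.  The factor [theta] makes the dependence of the
    forces on the unknown [m] as weak as that on [U] and [V]. *)
Definition forceU m U V s : R :=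
  theta * m * (k ^+ 2 * U s) + (1 - theta * m) * n1 (U s) (V s).

(** The force on [V] without its part [theta * m * cos]. *)
Definition restV m U V s : R :=
  theta * m * (V s - cos s) + (1 - theta * m) * n2 (U s) (V s).

(** The detuning which makes the force on the resonant mode orthogonal to
    [cos] over a half period. *)
Definition detuning m U V : R :=
  - (2 / (pi * theta)) * prim (fun t => cos (1 * t) * restV m U V t) pi.

(** Here the resonant part is taken with the new detuning instead of [m]; the
    two agree at a fixed point. *)
Definition forceV m U V s : R :=
  restV m U V s + theta * detuning m U V * cos s.

Hypothesis theta0 : 0 < theta.
Hypothesis theta1 : theta <= 1.
Hypothesis n1_lip : lip_on 2 (theta / 256) n1.
Hypothesis n2_lip : lip_on 2 (theta / 256) n2.

(** For the radius 1/16 and nonlinear terms of Lipschitz constant [theta / 256],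
    the detuning stays in the admissible range and varies by a factor below 1/2;
    only the products [m * (V - cos)] and the nonlinear terms enter it. *)
Definition admissible m U V : Prop :=
  [/\ `|m| <= 1 / 16,
      continuous U /\ even_periodic U, (forall s, `|U s| <= 1 / 16),
      continuous V /\ even_periodic V & (forall s, `|V s - cos s| <= 1 / 16)].

Lemma admissible_le2 m U V s : admissible m U V ->
  `|U s| <= 2 /\ `|V s| <= 2.
Proof.
move=> [_ _ Ub _ Vb]; split; first by apply: le_trans (Ub s) _; lra.
rewrite -[V s](subrK (cos s)); apply: le_trans (ler_normD _ _) _.
by have := Vb s; have := cos_max s; lra.
Qed.

Lemma detuned_le m U V : admissible m U V ->
  `|theta * m| <= theta / 16 /\ `|1 - theta * m| <= 2.
Proof.
move=> [mb _ _ _ _].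
have h : `|theta * m| <= theta / 16.
  by rewrite normrM (gtr0_norm theta0); have := ler_wpM2l (ltW theta0) mb; lra.
split => //; apply: le_trans (ler_normB _ _) _; rewrite normr1.
by have := theta1; lra.
Qed.

Section nonlinearity.
Variable n : R -> R -> R.
Hypothesis n_lip : lip_on 2 (theta / 256) n.

Lemma nonlin_continuous m U V : admissible m U V ->
  continuous (fun s => n (U s) (V s)).
Proof.
move=> a s; case: (a) => _ [Uc _] _ [Vc _] _.
apply/cvgrPdist_le => e e0; pose d := e / (theta / 256).
have p256 : 0 < 256 :> R by rewrite ltr0n.
have d0 : 0 < d := divr_gt0 e0 (divr_gt0 theta0 p256).
near=> t; have -> : e = theta / 256 * d by rewrite /d; field; exact: lt0r_neq0.
have [? ?] := admissible_le2 s a; have [? ?] := admissible_le2 t a.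
apply: n_lip.2 => //; near: t.
- by move/cvgrPdist_le : (Uc s); apply.
- by move/cvgrPdist_le : (Vc s); apply.
Unshelve. all: by end_near. Qed.

Lemma nonlin_le0 m U V s : admissible m U V -> `|n (U s) (V s)| <= theta / 128.
Proof.
move=> a; have [? ?] := admissible_le2 s a.
have : `|n (U s) (V s) - n 0 0| <= theta / 256 * 2.
  by apply: n_lip.2; rewrite ?subr0 ?normr0.
by rewrite n_lip.1 subr0; lra.
Qed.

Lemma nonlin_le m U V s : admissible m U V ->
  `|(1 - theta * m) * n (U s) (V s)| <= theta / 64.
Proof.
move=> a; have [_ h] := detuned_le a; rewrite normrM.
have := ler_pM (normr_ge0 _) (normr_ge0 _) h (nonlin_le0 s a).
by lra.
Qed.

Lemma nonlin_lip m U V m' U' V' e s :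
  admissible m U V -> admissible m' U' V' -> `|m - m'| <= e ->
  `|U s - U' s| <= e -> `|V s - V' s| <= e ->
  `|(1 - theta * m) * n (U s) (V s) - (1 - theta * m') * n (U' s) (V' s)|
    <= theta / 64 * e.
Proof.
move=> a a' me Ue Ve; have [_ h] := detuned_le a.
have [? ?] := admissible_le2 s a; have [? ?] := admissible_le2 s a'.
have e0 : 0 <= e := le_trans (normr_ge0 _) me.
have h' := nonlin_le0 s a'.
have hm : `|(1 - theta * m) - (1 - theta * m')| <= theta * e.
  rewrite (_ : _ - _ = theta * (m' - m)); last by ring.
  by rewrite normrM (gtr0_norm theta0) distrC ler_wpM2l// ltW.
have hn : `|n (U s) (V s) - n (U' s) (V' s)| <= theta / 256 * e.
  exact: n_lip.2.
apply: le_trans (norm_mulB_le h h' hm hn) _.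
have : theta * e * theta <= theta * e * 1.
  by apply: ler_wpM2l theta1; rewrite mulr_ge0// ltW.
by have : 0 <= theta * e; [rewrite mulr_ge0// ltW|lra].
Qed.
End nonlinearity.

Lemma forceU_continuous m U V : admissible m U V -> continuous (forceU m U V).
Proof.
move=> a s; have nc := nonlin_continuous n1_lip a; case: a => _ [Uc _] _ _ _.
apply: cvgD; apply: cvgM; [exact: cvg_cst| |exact: cvg_cst|exact: nc].
by apply: cvgM; [exact: cvg_cst|exact: Uc].
Qed.

Lemma restV_continuous m U V : admissible m U V -> continuous (restV m U V).
Proof.
move=> a s; have nc := nonlin_continuous n2_lip a; case: a => _ _ _ [Vc _] _.
apply: cvgD; apply: cvgM; [exact: cvg_cst| |exact: cvg_cst|exact: nc].
by apply: cvgB; [exact: Vc|exact: continuous_cos].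
Qed.

Lemma forceV_continuous m U V : admissible m U V -> continuous (forceV m U V).
Proof.
move=> a s; apply: cvgD; first exact: restV_continuous.
by apply: cvgM; [exact: cvg_cst|exact: continuous_cos].
Qed.

Lemma forceU_even_periodic m U V : admissible m U V ->
  even_periodic (forceU m U V).
Proof.
by case=> _ [_ [Ue Up]] _ [_ [Ve Vp]] _; split=> s;
  rewrite /forceU ?Ue ?Ve ?Up ?Vp.
Qed.

Lemma forceV_even_periodic m U V : admissible m U V ->
  even_periodic (forceV m U V).
Proof.
have [ce cp] := even_periodic_cos R.
by case=> _ [_ [Ue Up]] _ [_ [Ve Vp]] _; split=> s;
  rewrite /forceV /restV ?Ue ?Ve ?Up ?Vp ?ce ?cp.
Qed.

Lemma forceU_le m U V s : admissible m U V ->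
  `|forceU m U V s| <= theta * (1 + k ^+ 2).
Proof.
move=> a; apply: le_trans (ler_normD _ _) _.
have h := nonlin_le n1_lip s a; have [tm _] := detuned_le a.
case: a => _ _ Ub _ _; have k2 := sqr_ge0 k.
have : `|theta * m * (k ^+ 2 * U s)| <= theta / 16 * (k ^+ 2 * (1 / 16)).
  by rewrite normrM ler_pM// normrM (ger0_norm k2) ler_wpM2l.
have : 0 <= theta * k ^+ 2 by rewrite mulr_ge0// ltW.
by have := theta0; lra.
Qed.

Lemma restV_le m U V s : admissible m U V -> `|restV m U V s| <= theta * (5 / 256).
Proof.
move=> a; apply: le_trans (ler_normD _ _) _.
have h := nonlin_le n2_lip s a; have [tm _] := detuned_le a.
case: a => _ _ _ _ Vb.
have : `|theta * m * (V s - cos s)| <= theta / 16 * (1 / 16).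
  by rewrite normrM ler_pM.
by lra.
Qed.

Let theta_pi : 0 < 2 / (pi * theta).
Proof. by rewrite divr_gt0// mulr_gt0// pi_gt0. Qed.

Section two_points.
Variables (m m' e : R) (U V U' V' : R -> R).
Hypothesis a : admissible m U V.
Hypothesis a' : admissible m' U' V'.
Hypothesis me : `|m - m'| <= e.
Hypothesis Ue : forall s, `|U s - U' s| <= e.
Hypothesis Ve : forall s, `|V s - V' s| <= e.

Let e0 : 0 <= e := le_trans (normr_ge0 _) me.
Let te0 : 0 <= theta * e := mulr_ge0 (ltW theta0) e0.

Let tme : `|theta * m - theta * m'| <= theta * e.
Proof. by rewrite -mulrBr normrM (gtr0_norm theta0) ler_wpM2l// ltW. Qed.

Lemma forceU_lip s :
  `|forceU m U V s - forceU m' U' V' s| <= theta * (1 + k ^+ 2) * e.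
Proof.
rewrite /forceU [X in `|X|](_ : _ =
  (theta * m * (k ^+ 2 * U s) - theta * m' * (k ^+ 2 * U' s)) +
  ((1 - theta * m) * n1 (U s) (V s) - (1 - theta * m') * n1 (U' s) (V' s)));
  last by ring.
apply: le_trans (ler_normD _ _) _.
have h := nonlin_lip n1_lip a a' me (Ue s) (Ve s); have [tm _] := detuned_le a.
have k2 := sqr_ge0 k.
have kU : `|k ^+ 2 * U' s| <= k ^+ 2 * (1 / 16).
  by rewrite normrM (ger0_norm k2) ler_wpM2l//; case: a'.
have kUe : `|k ^+ 2 * U s - k ^+ 2 * U' s| <= k ^+ 2 * e.
  by rewrite -mulrBr normrM (ger0_norm k2) ler_wpM2l.
have := norm_mulB_le tm kU tme kUe.
have : 0 <= theta * e * k ^+ 2 by rewrite mulr_ge0.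
by have := te0; lra.
Qed.

Lemma restV_lip s :
  `|restV m U V s - restV m' U' V' s| <= theta * (9 / 64) * e.
Proof.
rewrite /restV [X in `|X|](_ : _ =
  (theta * m * (V s - cos s) - theta * m' * (V' s - cos s)) +
  ((1 - theta * m) * n2 (U s) (V s) - (1 - theta * m') * n2 (U' s) (V' s)));
  last by ring.
apply: le_trans (ler_normD _ _) _.
have h := nonlin_lip n2_lip a a' me (Ue s) (Ve s); have [tm _] := detuned_le a.
have VV : `|V' s - cos s| <= 1 / 16 by case: a'.
have VVe : `|(V s - cos s) - (V' s - cos s)| <= e.
  by rewrite (_ : _ - _ = V s - V' s)//; ring.
by have := norm_mulB_le tm VV tme VVe; have := te0; lra.
Qed.

Lemma detuning_lip : `|detuning m U V - detuning m' U' V'| <= 9 / 32 * e.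
Proof.
rewrite /detuning -mulrBr normrM normrN (gtr0_norm theta_pi).
have pipi : 0 <= (pi : R) <= pi by rewrite pi_ge0 lexx.
have [h _] := prim_trig_lip 1 (restV_continuous a) (restV_continuous a')
  restV_lip pipi.
have -> : 9 / 32 * e = 2 / (pi * theta) * (pi * (theta * (9 / 64) * e)).
  by move: (pi : R) (pi_gt0 R) => p p0; field; rewrite !lt0r_neq0.
by rewrite ler_wpM2l// divr_ge0// mulr_ge0 ?pi_ge0// ltW.
Qed.

Lemma forceV_lip s :
  `|forceV m U V s - forceV m' U' V' s| <= theta * (1 / 2) * e.
Proof.
rewrite /forceV [X in `|X|](_ : _ = (restV m U V s - restV m' U' V' s) +
  theta * ((detuning m U V - detuning m' U' V') * cos s)); last by ring.
apply: le_trans (ler_normD _ _) _; rewrite normrM (gtr0_norm theta0).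
have h : `|(detuning m U V - detuning m' U' V') * cos s| <= 9 / 32 * e * 1.
  by rewrite normrM ler_pM//; [exact: detuning_lip|exact: cos_max].
have := ler_wpM2l (ltW theta0) h; have := restV_lip s; have := te0; lra.
Qed.
End two_points.

Lemma detuning_le m U V : admissible m U V -> `|detuning m U V| <= 1 / 16.
Proof.
move=> a; rewrite /detuning normrM normrN (gtr0_norm theta_pi).
have pipi : 0 <= (pi : R) <= pi by rewrite pi_ge0 lexx.
have rest0 x : `|restV m U V x - 0| <= theta * (5 / 256).
  by rewrite subr0; exact: restV_le.
have [h _] := prim_trig_lip 1 (restV_continuous a)
  (fun x => @cst_continuous _ _ (0 : R) x) rest0 pipi.
have prim0E : prim (fun t => cos (1 * t) * (0 : R)) pi = 0.
  by under eq_fun do rewrite mulr0; rewrite prim_zero.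
rewrite prim0E subr0 in h.
apply: (@le_trans _ _ (2 / (pi * theta) * (pi * (theta * (5 / 256))))).
  by rewrite ler_wpM2l// divr_ge0// mulr_ge0 ?pi_ge0// ltW.
have -> : 2 / (pi * theta) * (pi * (theta * (5 / 256))) = 5 / 128; last by lra.
by move: (pi : R) (pi_gt0 R) => p p0; field; rewrite !lt0r_neq0.
Qed.

Lemma forceV_le m U V s : admissible m U V ->
  `|forceV m U V s| <= theta * (1 / 8).
Proof.
move=> a; apply: le_trans (ler_normD _ _) _.
rewrite -mulrA normrM (gtr0_norm theta0).
have h : `|detuning m U V * cos s| <= 1 / 16 * 1.
  by rewrite normrM ler_pM//; [exact: detuning_le|exact: cos_max].
by have := ler_wpM2l (ltW theta0) h; have := restV_le s a; have := theta0; lra.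
Qed.

Lemma forceV_orthogonal m U V : admissible m U V ->
  prim (fun t => cos (1 * t) * forceV m U V t) pi = 0.
Proof.
move=> a; rewrite /forceV prim_cos_project; last exact: restV_continuous.
rewrite /detuning; move: (prim _ _) => c.
by move: (pi : R) (pi_gt0 R) => p p0; field; rewrite !lt0r_neq0.
Qed.
End contraction.

(** * Existence of the rescaled motion *)

Lemma uniform_limit_even_periodic (R : realType) (z : R -> R) :
  (forall e : R, 0 < e -> exists w : R -> R,
    [/\ continuous w, even_periodic w & forall s, `|z s - w s| <= e]) ->
  continuous z /\ even_periodic z.
Proof.
move=> zw; split.
  move=> s; apply/cvgrPdist_le => e e0.
  have [w [wc _ wz]] := zw (e / 3) ltac:(lra).
  near=> t; have h : `|w s - w t| <= e / 3.
    by near: t; move/cvgrPdist_le : (wc s); apply; lra.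
  rewrite (_ : z s - z t = (z s - w s) + (w s - w t) - (z t - w t)); last by ring.
  apply: le_trans (ler_normB _ _) _.
  have := ler_normD (z s - w s) (w s - w t).
  by have := wz s; have := wz t; lra.
have zeq a b : (forall w, even_periodic w -> w a = w b) -> z a = z b.
  move=> wab; apply/eqP; rewrite -subr_eq0 -normr_eq0 eq_le normr_ge0 andbT.
  apply/ler_addgt0Pr => e e0; rewrite add0r.
  have [w [_ wep wz]] := zw (e / 2) ltac:(lra).
  rewrite (_ : z a - z b = (z a - w a) - (z b - w b)); last first.
    by rewrite (wab w wep); ring.
  apply: le_trans (ler_normB _ _) _.
  by have := wz a; have := wz b; lra.
by split=> s; apply: zeq => w [].
Unshelve. all: by end_near. Qed.

(** [K] bounds the norms of both solution operators on [0, pi]; [theta] is small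
    compared with [1 / K], and the nonlinear terms are small compared with
    [theta]. *)
Section periodic_solution.
Context {R : realType} (k theta K : R) (n1 n2 : R -> R -> R).

Hypothesis k0 : 0 < k.
Hypothesis sink : sin (k * pi) != 0.
Hypothesis theta0 : 0 < theta.
Hypothesis theta1 : theta <= 1.
Hypothesis K_osc : 2 * pi <= K.
Hypothesis K_response : 2 * pi / k + 2 * pi / (k * `|sin (k * pi)|) <= K.
Hypothesis K_theta : K * theta * (1 + k ^+ 2) <= 1 / 64.
Hypothesis n1_lip : lip_on 2 (theta / 256) n1.
Hypothesis n2_lip : lip_on 2 (theta / 256) n2.

Implicit Types (m e s : R) (U V : R -> R).

Let fU := forceU k theta n1.
Let fV := forceV theta n2.

Let K_theta' : K * theta <= 1 / 64.
Proof.
have K0 : 0 <= K by apply: le_trans K_osc; rewrite mulr_ge0 ?pi_ge0.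
have : 0 <= K * theta * k ^+ 2 by rewrite !mulr_ge0// ltW.
by have := K_theta; lra.
Qed.

Definition updateU m (U V : R -> R) : R -> R := response k (fU m U V).
Definition updateV m (U V : R -> R) (s : R) : R := cos s + osc 1 (fV m U V) s.

Lemma updateU_lip m U V m' U' V' e : admissible m U V -> admissible m' U' V' ->
  `|m - m'| <= e -> (forall s, `|U s - U' s| <= e) ->
  (forall s, `|V s - V' s| <= e) ->
  forall s, `|updateU m U V s - updateU m' U' V' s| <= e / 2.
Proof.
move=> a a' me Ue Ve s; have e0 : 0 <= e := le_trans (normr_ge0 _) me.
have h := response_lip k0 sink (forceU_continuous theta0 n1_lip a)
  (forceU_continuous theta0 n1_lip a') (forceU_even_periodic k theta n1 a)
  (forceU_even_periodic k theta n1 a')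
  (forceU_lip k theta0 theta1 n1_lip a a' me Ue Ve) s.
apply: le_trans h _; have t0 : 0 <= theta * (1 + k ^+ 2) * e.
  by rewrite !mulr_ge0// ?addr_ge0 ?sqr_ge0// ltW.
apply: le_trans (ler_wpM2r t0 K_response) _.
by have := ler_wpM2r e0 K_theta; lra.
Qed.

Lemma updateU_le m U V s : admissible m U V -> `|updateU m U V s| <= 1 / 16.
Proof.
move=> a; have force0 x : `|fU m U V x - 0| <= theta * (1 + k ^+ 2).
  by rewrite subr0; exact: forceU_le.
have := response_lip k0 sink (forceU_continuous theta0 n1_lip a)
  (fun x => @cst_continuous _ _ (0 : R) x) (forceU_even_periodic k theta n1 a)
  (conj (fun=> erefl) (fun=> erefl)) force0 s.
have -> : response k (fun=> 0) s = 0.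
  by rewrite /response osc_zero oscD_zero !mul0r addr0.
rewrite subr0 => h; apply: le_trans h _.
have t0 : 0 <= theta * (1 + k ^+ 2).
  by rewrite mulr_ge0 ?addr_ge0 ?sqr_ge0// ltW.
by have := ler_wpM2r t0 K_response; have := K_theta; lra.
Qed.

Lemma osc_forceV_even_periodic m U V : admissible m U V ->
  even_periodic (osc 1 (fV m U V)).
Proof.
move=> a; apply: osc1_even_periodic; first exact: forceV_continuous.
- exact: forceV_even_periodic.
- exact: forceV_orthogonal.
Qed.

Lemma updateV_lip m U V m' U' V' e : admissible m U V -> admissible m' U' V' ->
  `|m - m'| <= e -> (forall s, `|U s - U' s| <= e) ->
  (forall s, `|V s - V' s| <= e) ->
  forall s, `|updateV m U V s - updateV m' U' V' s| <= e / 2.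
Proof.
move=> a a' me Ue Ve s; have e0 : 0 <= e := le_trans (normr_ge0 _) me.
rewrite /updateV opprD addrACA subrr add0r; move: s.
apply: even_periodic_le.
  by apply: even_periodicB; exact: osc_forceV_even_periodic.
move=> s spi; have h := osc_lip ltr01 (forceV_continuous theta0 n2_lip a)
  (forceV_continuous theta0 n2_lip a')
  (forceV_lip theta0 theta1 n2_lip a a' me Ue Ve) spi.
apply: le_trans h _; rewrite divr1.
have t0 : 0 <= theta * (1 / 2) * e by rewrite !mulr_ge0// ltW.
apply: le_trans (ler_wpM2r t0 K_osc) _.
by have := ler_wpM2r e0 K_theta'; lra.
Qed.

Lemma updateV_le m U V s : admissible m U V ->
  `|updateV m U V s - cos s| <= 1 / 16.
Proof.
move=> a; rewrite /updateV addrAC subrr add0r; move: s.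
apply: even_periodic_le; first exact: osc_forceV_even_periodic.
move=> s spi; have force0 x : `|fV m U V x - 0| <= theta * (1 / 8).
  by rewrite subr0; exact: forceV_le.
have := osc_lip ltr01 (forceV_continuous theta0 n2_lip a)
  (fun x => @cst_continuous _ _ (0 : R) x) force0 spi.
rewrite osc_zero subr0 divr1 => h; apply: le_trans h _.
have t0 : 0 <= theta * (1 / 8) by rewrite mulr_ge0// ltW.
by have := ler_wpM2r t0 K_osc; have := K_theta'; lra.
Qed.

Lemma update_admissible m U V : admissible m U V ->
  admissible (detuning theta n2 m U V) (updateU m U V) (updateV m U V).
Proof.
move=> a.
have Uc : continuous (fU m U V) := forceU_continuous theta0 n1_lip a.
have Vc := forceV_continuous theta0 n2_lip a.
split.
- exact: detuning_le.
- have Uep := forceU_even_periodic k theta n1 a.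
  split; last exact: (@response_even_periodic _ k k0 sink _ Uc Uep).
  by move=> s; exact: is_derive_continuous (response_derive k0 sink s Uc).
- by move=> s; exact: updateU_le.
- split.
    move=> s; apply: cvgD; first exact: continuous_cos.
    exact: is_derive_continuous (osc_derive ltr01 s Vc).
  have [oe op] := osc_forceV_even_periodic a.
  have [ce cp] := even_periodic_cos R.
  by split=> s; rewrite /updateV ?oe ?ce ?op ?cp.
- by move=> s; exact: updateV_le.
Qed.

(** At a fixed point the force on [V] has no resonant part, so the equation for
    [V] is solved exactly, and [m] is the detuning of the period. *)
Lemma update_fixed_point : exists m U V,
  [/\ admissible m U V, detuning theta n2 m U V = m,
      updateU m U V =1 U & updateV m U V =1 V].
Proof.
(* [None] carries the detuning, [Some (false, s)] and [Some (true, s)] the two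
   modes at time [s] *)
pose X := option (bool * R).
pose zU (z : X -> R) s := z (Some (false, s)).
pose zV (z : X -> R) s := z (Some (true, s)).
pose S (z : X -> R) := admissible (z None) (zU z) (zV z).
pose Phi (z : X -> R) (x : X) : R := match x with
  | None => detuning theta n2 (z None) (zU z) (zV z)
  | Some (false, s) => updateU (z None) (zU z) (zV z) s
  | Some (true, s) => updateV (z None) (zU z) (zV z) s end.
pose z0 (x : X) : R := if x is Some (true, s) then cos s else 0.
have Sz0 : S z0.
  split; rewrite ?normr0//; first by split=> // s; exact: cst_continuous.
  - by move=> s; rewrite normr0.
  - split; [exact: continuous_cos|exact: even_periodic_cos].
  - by move=> s; rewrite /zV/= subrr normr0.
have [|z|z w e Sz Sw zwe|z zS|z Sz zfix] :=
    @uniform_fixed_point R X S Phi z0 (1 / 16) Sz0.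
- have [d _ u _ v] := update_admissible Sz0.
  by case=> [[[] s]|]; [exact: v|rewrite subr0; exact: u|rewrite subr0; exact: d].
- exact: update_admissible.
- case=> [[[] s]|].
  + exact: updateV_lip Sz Sw (zwe None) (fun t => zwe (Some (false, t)))
      (fun t => zwe (Some (true, t))) s.
  + exact: updateU_lip Sz Sw (zwe None) (fun t => zwe (Some (false, t)))
      (fun t => zwe (Some (true, t))) s.
  + have e0 : 0 <= e := le_trans (normr_ge0 _) (zwe None).
    have h := detuning_lip theta0 theta1 n2_lip Sz Sw (zwe None)
      (fun t => zwe (Some (false, t))) (fun t => zwe (Some (true, t))).
    by apply: le_trans h _; lra.
- have close (x : X) (f : R) (b : R) :
      (forall w, S w -> `|w x - f| <= b) -> `|z x - f| <= b.
    move=> wb; apply/ler_addgt0Pr => e e0; have [w Sw zwe] := zS e e0.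
    rewrite -(subrKA (w x)) addrC; apply: le_trans (ler_normD _ _) _.
    by rewrite lerD// wb.
  split.
  + by rewrite -[z None]subr0; apply: close => w []; rewrite subr0.
  + apply: uniform_limit_even_periodic => e e0; have [w Sw zwe] := zS e e0.
    exists (zU w); case: Sw => _ [? ?] _ _ _; split=> // s.
    exact: (zwe (Some (false, s))).
  + move=> s; rewrite -[zU z s]subr0; apply: close => w [_ _ + _ _].
    by move=> /(_ s); rewrite subr0.
  + apply: uniform_limit_even_periodic => e e0; have [w Sw zwe] := zS e e0.
    exists (zV w); case: Sw => _ _ _ [? ?] _; split=> // s.
    exact: (zwe (Some (true, s))).
  + by move=> s; apply: close => w [_ _ _ _ +]; apply.
exists (z None), (zU z), (zV z); split=> //.
- exact: (zfix None).
- by move=> s; exact: (zfix (Some (false, s))).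
- by move=> s; exact: (zfix (Some (true, s))).
Qed.

Lemma rescaled_solution : exists (m : R) (U U' V V' : R -> R),
  [/\ admissible m U V, forall s : R, is_derive s 1 U (U' s),
      forall s : R, is_derive s 1 U'
        ((1 - theta * m) * (n1 (U s) (V s) - k ^+ 2 * U s)),
      forall s : R, is_derive s 1 V (V' s) &
      forall s : R, is_derive s 1 V'
        ((1 - theta * m) * (n2 (U s) (V s) - V s))].
Proof.
have [m [U [V [a dm /funext uU /funext uV]]]] := update_fixed_point.
have fUc : continuous (fU m U V) := forceU_continuous theta0 n1_lip a.
have fVc : continuous (fV m U V) := forceV_continuous theta0 n2_lip a.
exists m, U, (responseD k (fU m U V)), V.
exists (fun s => - sin s + oscD 1 (fV m U V) s); split=> // s.
- by rewrite -[X in is_derive _ _ X]uU; exact: response_derive.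
- have := responseD_derive k0 sink s fUc.
  rewrite -/(updateU m U V) uU => h; apply: is_derive_eq.
  by rewrite /fU /forceU; ring.
- rewrite -[X in is_derive _ _ X]uV /updateV.
  by have ? := osc_derive ltr01 s fVc; exact: is_derive_eq.
- have ? := oscD_derive ltr01 s fVc; apply: is_derive_eq.
  have Vs : osc 1 (fV m U V) s = V s - cos s.
    by rewrite -[in RHS]uV /updateV addrAC subrr add0r.
  by rewrite Vs /fV /forceV dm /restV /GRing.scale/=; ring.
Qed.

End periodic_solution.

(** * Lyapunov's center theorem *)

(** Vanishing to first order at the origin, in the strict sense. *)
Definition strictly_small (R : realType) (n : R -> R -> R) : Prop :=
  forall eta : R, 0 < eta -> exists2 r : R, 0 < r & lip_on r eta n.

Lemma lip_onW (R : realType) (r r' eta : R) (n : R -> R -> R) :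
  r' <= r -> lip_on r eta n -> lip_on r' eta n.
Proof.
move=> rr [n0 nl]; split=> // u v u' v' d *.
by apply: nl => //; apply: le_trans rr.
Qed.

Lemma lip_on_scale (R : realType) (r eta b : R) (n : R -> R -> R) :
  0 < r -> 0 < b -> lip_on (2 * r) (eta * b) n ->
  lip_on 2 eta (fun u v => n (r * u) (r * v) / (r * b)).
Proof.
move=> r0 b0 [n0 nl]; split=> [|u v u' v' d u2 v2 u'2 v'2 ud vd].
  by rewrite !mulr0 n0 mul0r.
have bound x : `|x| <= 2 -> `|r * x| <= 2 * r.
  by move=> x2; rewrite normrM (gtr0_norm r0) mulrC ler_pM2r.
have diff x y : `|x - y| <= d -> `|r * x - r * y| <= r * d.
  by move=> xy; rewrite -mulrBr normrM (gtr0_norm r0) ler_pM2l.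
have rb0 : 0 < r * b by exact: mulr_gt0.
rewrite -mulrBl normrM normfV (gtr0_norm rb0) ler_pdivrMr//.
have := nl _ _ _ _ _ (bound _ u2) (bound _ v2) (bound _ u'2) (bound _ v'2)
  (diff _ _ ud) (diff _ _ vd).
by rewrite (_ : eta * b * (r * d) = eta * d * (r * b))//; ring.
Qed.

Lemma sqrt_near1 (R : realType) (x : R) : 0 <= x -> `|Num.sqrt x - 1| <= `|x - 1|.
Proof.
move=> x0; have s0 := sqrtr_ge0 x.
rewrite -[in leRHS](sqr_sqrtr x0) -[X in _ <= `|_ - X|](expr1n _ 2) subr_sqr.
rewrite normrM ler_peMr//; apply: le_trans (ler_norm _); lra.
Qed.

(** Lyapunov's center theorem for the mode of frequency [sqrt b], with the other
    frequency [sqrt a] not an integer multiple of it.  With amplitude [r], the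
    rescaled nonlinear terms [n (r u) (r v) / (r b)] have an arbitrarily small
    Lipschitz constant, so the contraction applies; [U], [V] and the rescaled
    time [w * t] then give the motion, of period [2 pi / w]. *)
Lemma brake_orbits (R : realType) (a b : R) (n1 n2 : R -> R -> R) (delta : R) :
  0 < a -> 0 < b -> sin (Num.sqrt a / Num.sqrt b * pi) != 0 ->
  strictly_small n1 -> strictly_small n2 -> 0 < delta ->
  exists (A A' B B' : R -> R) (T : R),
  [/\ (forall t : R, is_derive t 1 A (A' t) /\
        is_derive t 1 A' (n1 (A t) (B t) - a * A t)),
      (forall t : R, is_derive t 1 B (B' t) /\
        is_derive t 1 B' (n2 (A t) (B t) - b * B t)),
      (forall t, `|A t| <= delta /\ `|B t| <= delta),
      (forall t, A (t + T) = A t /\ B (t + T) = B t) &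
      [/\ 0 < T, `|T - 2 * pi / Num.sqrt b| < delta, B 0 != B (T / 2) &
      forall S : R, 0 < S -> (forall t, B (t + S) = B t) -> T <= S]].
Proof.
move=> a0 b0 sink small1 small2 delta0; have pi0 := pi_gt0 R.
set k := Num.sqrt a / Num.sqrt b in sink *.
have sa0 : 0 < Num.sqrt a by rewrite sqrtr_gt0.
have sb0 : 0 < Num.sqrt b by rewrite sqrtr_gt0.
have k0 : 0 < k by rewrite divr_gt0.
have k2 : k ^+ 2 = a / b by rewrite expr_div_n !sqr_sqrtr ?ltW.
have ks0 : 0 < k * `|sin (k * pi)| by rewrite mulr_gt0// normr_gt0.
pose K := 2 * pi + (2 * pi / k + 2 * pi / (k * `|sin (k * pi)|)).
have Ko : 2 * pi <= K by rewrite lerDl addr_ge0// divr_ge0 ?mulr_ge0// ltW.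
have Kr : 2 * pi / k + 2 * pi / (k * `|sin (k * pi)|) <= K.
  by rewrite lerDr mulr_ge0// ltW.
have K0 : 0 < K by apply: lt_le_trans Ko; rewrite mulr_gt0.
pose T0 := 2 * pi / Num.sqrt b.
have T00 : 0 < T0 by rewrite divr_gt0// mulr_gt0.
pose c := 64 * K * (1 + k ^+ 2).
have k20 := sqr_ge0 k.
have c0 : 0 < c by rewrite /c !mulr_gt0//; lra.
pose theta := Num.min 1 (Num.min c^-1 (delta / T0)).
have theta0 : 0 < theta by rewrite !lt_min ltr01 invr_gt0 c0 divr_gt0.
have [theta1 thetac thetaT] : [/\ theta <= 1, theta <= c^-1 & theta <= delta / T0].
  by split; rewrite !ge_min lexx ?orbT.
have Kt : K * theta * (1 + k ^+ 2) <= 1 / 64.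
  have : c * theta <= 1 by rewrite mulrC -ler_pdivlMr// mul1r.
  by rewrite /c; lra.
clearbody theta K.
have p256 : 0 < 256 :> R by rewrite ltr0n.
have etab : 0 < theta / 256 * b := mulr_gt0 (divr_gt0 theta0 p256) b0.
have [r1 r10 l1] := small1 _ etab; have [r2 r20 l2] := small2 _ etab.
pose r := Num.min (delta / 2) (Num.min (r1 / 2) (r2 / 2)).
have r0 : 0 < r by rewrite !lt_min !divr_gt0.
have [rd rr1 rr2] : [/\ 2 * r <= delta, 2 * r <= r1 & 2 * r <= r2].
  by split; rewrite mulrC -ler_pdivlMr// !ge_min lexx ?orbT.
clearbody r.
have [m [U [U' [V [V' [adm dU dU' dV dV']]]]]] := rescaled_solution k0 sink theta0
  theta1 Ko Kr Kt (lip_on_scale r0 b0 (lip_onW rr1 l1))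
  (lip_on_scale r0 b0 (lip_onW rr2 l2)).
have [tm _] := detuned_le theta0 theta1 adm.
pose x := 1 - theta * m; have x0 : 0 < x.
  by move/ler_normlP : tm => [_ h]; rewrite /x; lra.
have q0 : 0 < Num.sqrt x by rewrite sqrtr_gt0.
pose w := Num.sqrt b / Num.sqrt x; have w0 : 0 < w by rewrite divr_gt0.
have w2 : w ^+ 2 * x = b.
  by rewrite expr_div_n !sqr_sqrtr ?ltW// divfK// lt0r_neq0.
have accel N c' y :
    r * (w ^+ 2 * x) * (N / (r * b) - c' / b * y) = N - c' * (r * y).
  by rewrite w2; field; rewrite !lt0r_neq0.
pose T := 2 * pi / w.
have wT : w * T = 2 * pi by rewrite mulrC divfK// lt0r_neq0.
have le2 s := admissible_le2 s adm.
case: (adm) => _ [_ [_ Up]] _ [_ [_ Vp]] Vcos.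
exists (fun t => r * U (w * t)), (fun t => r * w * U' (w * t)).
exists (fun t => r * V (w * t)), (fun t => r * w * V' (w * t)), T; split.
- move=> t; split; apply: is_derive_eq; rewrite /GRing.scale/=; first by ring.
  by rewrite k2 -accel /x; ring.
- move=> t; split; apply: is_derive_eq; rewrite /GRing.scale/=; first by ring.
  by rewrite -accel divff ?lt0r_neq0// mul1r /x; ring.
- by move=> t; have [u v] := le2 (w * t); split; rewrite normrM (gtr0_norm r0);
    apply: le_trans rd; rewrite mulrC ler_pM2r.
- by move=> t; rewrite mulrDr wT Up Vp.
split.
- by rewrite divr_gt0// mulr_gt0.
- have -> : T - 2 * pi / Num.sqrt b = T0 * (Num.sqrt x - 1).
    by rewrite /T /T0 /w; field; rewrite !lt0r_neq0.
  rewrite normrM (gtr0_norm T00) mulrC -ltr_pdivlMr//.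
  apply: le_lt_trans (sqrt_near1 (ltW x0)) _; apply: lt_le_trans thetaT.
  by rewrite /x addrAC subrr add0r normrN; lra.
- have -> : w * (T / 2) = pi by rewrite mulrA wT mulrAC mulfV ?mul1r.
  rewrite (inj_eq (mulfI (lt0r_neq0 r0))) mulr0.
  have := Vcos 0; have := Vcos pi; rewrite cospi cos0.
  by move=> /ler_normlP[? ?] /ler_normlP[? ?]; apply/eqP; lra.
- move=> S S0 BS; rewrite /T ler_pdivrMr// [leRHS]mulrC.
  apply: (@cos_like_min_period _ V) => //; last 2 first.
  + by rewrite mulr_gt0.
  + move=> s; have := BS (s / w); rewrite mulrDr mulrCA mulfV ?lt0r_neq0// mulr1.
    by move/(mulfI (lt0r_neq0 r0)).
  + by move=> s; apply: le_lt_trans (Vcos s) _; lra.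
Qed.

(** * Strict differentiability *)

(** Strict differentiability at the origin: the differential controls the
    difference of any two nearby values.  This is what survives as a small
    Lipschitz constant once the linear part is removed. *)
Definition strict_diff (R : realType) (V : normedModType R) (f l : V -> R) :=
  (exists2 C : R, 0 < C & forall v, `|l v| <= C * `|v|) /\
  forall eta : R, 0 < eta -> \forall r \near 0^'+,
    forall x y : V, `|x| <= r -> `|y| <= r ->
    `|f x - f y - l (x - y)| <= eta * `|x - y|.

Section strict_diff.
Context {R : realType} {V : normedModType R}.
Implicit Types (f g l : V -> R) (c : R).

Lemma strict_diff_eq f f' l l' :
  strict_diff f l -> f =1 f' -> l =1 l' -> strict_diff f' l'.
Proof. by move=> ? /funext <- /funext <-. Qed.

Lemma strict_diff_affine c l :
  (exists2 C : R, 0 < C & forall v, `|l v| <= C * `|v|) ->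
  {morph l : x y / x - y} -> strict_diff (fun z => c + l z) l.
Proof.
move=> lC lB; split=> // eta eta0; near=> r => x y _ _.
by rewrite lB opprD addrACA subrr add0r subrr normr0 mulr_ge0// ltW.
Unshelve. all: by end_near. Qed.

Lemma strict_diff_cst c : strict_diff (fun _ : V => c) (fun=> 0).
Proof.
split; first by exists 1 => // v; rewrite normr0 mul1r.
move=> eta eta0; near=> r => x y _ _.
by rewrite !subrr normr0 mulr_ge0// ltW.
Unshelve. all: by end_near. Qed.

Lemma strict_diff_near0 f l : strict_diff f l -> forall e : R, 0 < e ->
  \forall r \near 0^'+, forall x, `|x| <= r -> `|f x - f 0| <= e.
Proof.
move=> [[C C0 lC] sf] e e0; have C1 : 0 < C + 1 by rewrite addr_gt0.
near=> r => x xr.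
have sfr : forall x y : V, `|x| <= r -> `|y| <= r ->
    `|f x - f y - l (x - y)| <= 1 * `|x - y|.
  by near: r; exact: sf.
have r0 : 0 <= r by exact: le_trans xr.
have re : r <= e / (C + 1) by near: r; apply: nbhs_right_le; rewrite divr_gt0.
rewrite ler_pdivlMr// in re.
have := sfr x 0 xr; rewrite normr0 subr0 mul1r => /(_ r0) h.
rewrite -[f x - f 0](subrK (l x)); apply: le_trans (ler_normD _ _) _.
have := lC x; have : C * `|x| <= C * r by rewrite ler_pM2l.
by lra.
Unshelve. all: by end_near. Qed.

Lemma strict_diffD f g lf lg : strict_diff f lf -> strict_diff g lg ->
  strict_diff (fun z => f z + g z) (fun v => lf v + lg v).
Proof.
move=> [[C C0 lfC] sf] [[D D0 lgD] sg]; split.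
  exists (C + D) => [|v]; first exact: addr_gt0.
  by rewrite mulrDl; apply: le_trans (ler_normD _ _) _; rewrite lerD.
move=> eta eta0; have e2 : 0 < eta / 2 by rewrite divr_gt0.
near=> r => x y xr yr.
have hf : `|f x - f y - lf (x - y)| <= eta / 2 * `|x - y|.
  by move: x y xr yr; near: r; exact: sf.
have hg : `|g x - g y - lg (x - y)| <= eta / 2 * `|x - y|.
  by move: x y xr yr {hf}; near: r; exact: sg.
rewrite (_ : _ - _ = (f x - f y - lf (x - y)) + (g x - g y - lg (x - y)));
  last by ring.
by rewrite (splitr eta) mulrDl; apply: le_trans (ler_normD _ _) _; exact: lerD.
Unshelve. all: by end_near. Qed.

Lemma strict_diffM f g lf lg : strict_diff f lf -> strict_diff g lg ->
  strict_diff (fun z => f z * g z) (fun v => f 0 * lg v + g 0 * lf v).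
Proof.
move=> Sf Sg; have [[C C0 lfC] sf] := Sf; have [[D D0 lgD] sg] := Sg; split.
  exists (`|f 0| * D + `|g 0| * C + 1) => [|v].
    by rewrite ltr_wpDl// addr_ge0// mulr_ge0// ltW.
  rewrite !mulrDl mul1r -!mulrA; apply: le_trans (ler_normD _ _) _.
  by rewrite ler_wpDr// !normrM lerD// ler_wpM2l.
move=> eta eta0; pose F := `|f 0| + 1; pose G := `|g 0| + 1.
have F0 : 0 < F by rewrite ltr_wpDl. have G0 : 0 < G by rewrite ltr_wpDl.
pose M := G + C + F + D; have M0 : 0 < M by rewrite /M; clearbody F G; lra.
pose e := Num.min 1 (eta / M).
have e0 : 0 < e by rewrite lt_min ltr01 divr_gt0.
have [e1 eM] : e <= 1 /\ e <= eta / M by split; rewrite ge_min lexx ?orbT.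
near=> r => x y xr yr; set d := `|x - y|; have d0 : 0 <= d by exact: normr_ge0.
have hf : `|f x - f y - lf (x - y)| <= e * d.
  by rewrite /d; move: x y xr yr {d d0}; near: r; exact: sf.
have hg : `|g x - g y - lg (x - y)| <= e * d.
  by rewrite /d; move: x y xr yr {d d0 hf}; near: r; exact: sg.
have nf : `|f y - f 0| <= e.
  by move: y yr {d d0 hf hg}; near: r; exact: strict_diff_near0 Sf _ e0.
have ng : `|g x - g 0| <= e.
  by move: x xr {d d0 hf hg}; near: r; exact: strict_diff_near0 Sg _ e0.
have fF : `|f y| <= F.
  rewrite -[f y](subrK (f 0)); apply: le_trans (ler_normD _ _) _.
  by rewrite addrC lerD2l; exact: le_trans nf e1.
have gG : `|g x| <= G.
  rewrite -[g x](subrK (g 0)); apply: le_trans (ler_normD _ _) _.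
  by rewrite addrC lerD2l; exact: le_trans ng e1.
rewrite (_ : _ - _ = (f x - f y - lf (x - y)) * g x + lf (x - y) * (g x - g 0)
  + (f y * (g x - g y - lg (x - y)) + (f y - f 0) * lg (x - y))); last by ring.
rewrite ler_pdivlMr// in eM.
have eMd : e * M * d <= eta * d by rewrite ler_wpM2r.
apply: le_trans eMd.
apply: le_trans (ler_normD _ _) _; rewrite (_ : e * M * d =
  (e * d * G + C * d * e) + (F * (e * d) + e * (D * d))); last by rewrite /M; ring.
by apply: lerD; (apply: le_trans (ler_normD _ _) _); rewrite !normrM;
  apply: lerD; apply: ler_pM.
Unshelve. all: by end_near. Qed.

Lemma strict_diffV f l : strict_diff f l -> f 0 = 1 ->
  strict_diff (fun z => (f z)^-1) (fun v => - l v).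
Proof.
move=> Sf f1; have [[C C0 lC] sf] := Sf; split.
  by exists C => // v; rewrite normrN.
move=> eta eta0; pose M := 2 * (1 + 3 * C).
have M0 : 0 < M by rewrite /M; lra.
pose e := Num.min (1 / 4) (eta / M).
have e0 : 0 < e by rewrite lt_min !divr_gt0.
have [e1 eM] : e <= 1 / 4 /\ e <= eta / M by split; rewrite ge_min lexx ?orbT.
near=> r => x y xr yr; set d := `|x - y|; have d0 : 0 <= d by exact: normr_ge0.
have hf : `|f x - f y - l (x - y)| <= e * d.
  by rewrite /d; move: x y xr yr {d d0}; near: r; exact: sf.
have near1 : forall z, `|z| <= r -> `|f z - 1| <= e.
  by rewrite -f1; near: r; exact: strict_diff_near0 Sf _ e0.
have fx := near1 x xr; have fy := near1 y yr.
have /ler_normlP[fx1 fx2] := fx; have /ler_normlP[fy1 fy2] := fy.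
have fx0 : 3 / 4 <= f x by lra. have fy0 : 3 / 4 <= f y by lra.
have fxy : 1 / 2 <= f x * f y.
  have : 3 / 4 * (3 / 4) <= f x * f y by apply: ler_pM => //; lra.
  by lra.
have fxy1 : `|f x * f y - 1| <= 3 * e.
  rewrite (_ : _ - 1 = (f x - 1) * f y + (f y - 1)); last by ring.
  apply: le_trans (ler_normD _ _) _; rewrite normrM.
  have : `|f x - 1| * `|f y| <= e * 2.
    by apply: ler_pM => //; apply/ler_normlP; split; lra.
  by lra.
rewrite (_ : _ - _ = (- (f x - f y - l (x - y)) + l (x - y) * (f x * f y - 1))
  / (f x * f y)); last by field; apply/andP; split; apply: lt0r_neq0; lra.
have fxy0 : 0 < f x * f y by lra.
rewrite normrM normfV (gtr0_norm fxy0) ler_pdivrMr//.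
apply: le_trans (ler_normD _ _) _; rewrite normrN normrM.
have : `|l (x - y)| * `|f x * f y - 1| <= C * d * (3 * e) by apply: ler_pM.
have : eta * d * (1 / 2) <= eta * d * (f x * f y).
  by rewrite ler_wpM2l// mulr_ge0// ltW.
rewrite ler_pdivlMr// in eM; have := ler_wpM2r d0 eM; rewrite /M.
by lra.
Unshelve. all: by end_near. Qed.

Lemma strict_diffX1 f l n : strict_diff f l -> f 0 = 1 ->
  strict_diff (fun z => f z ^+ n) (fun v => n%:R * l v).
Proof.
move=> Sf f1; elim: n => [|n IHn].
  by apply: strict_diff_eq (strict_diff_cst 1) _ _ => // v; rewrite mul0r.
apply: strict_diff_eq (strict_diffM Sf IHn) _ _ => v; first by rewrite exprS.
by rewrite f1 expr1n -natr1; ring.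
Qed.

End strict_diff.

Lemma strict_diff_small (R : realType) (f : R * R -> R) :
  f (0, 0) = 0 -> strict_diff f (fun=> 0) ->
  strictly_small (fun u v => f (u, v)).
Proof.
move=> f0 [_ sf] eta eta0.
have [/= r r0 fr] := sf eta eta0; exists (r / 2); first by rewrite divr_gt0.
split=> // u v u' v' d ur vr u'r v'r ud vd.
have r20 : 0 < r / 2 by rewrite divr_gt0.
have near_r : ball_ (fun x => `|x|) 0 r (r / 2).
  by rewrite /ball_/= sub0r normrN gtr0_norm; lra.
have norm_le (a b c : R) : `|a| <= c -> `|b| <= c -> `|(a, b)| <= c.
  by move=> ac bc; rewrite prod_normE/= ge_max ac.
have := fr _ near_r r20 (u, v) (u', v') (norm_le _ _ _ ur vr)
  (norm_le _ _ _ u'r v'r).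
rewrite subr0 => h; apply: le_trans h _; rewrite ler_pM2l//.
exact: norm_le.
Qed.

(** * The normal modes of an isosceles triangle *)

(** With [D] the squared distance, the force exerted on [q_i] by [q_j] is
    [repulsion D *: (q_i - q_j)]. *)
Definition repulsion (R : realType) (D : R) : R := 12 * (D^-1 ^+ 7 - D^-1 ^+ 4).

(** The accelerations of the triangle with vertices [(2 s X, 0)],
    [(- s X, Y)] and [(- s X, - Y)], where [s = 1 / sqrt 3]; its squared sides
    are [3 X^2 + Y^2], twice, and [4 Y^2]. *)
Definition accX (R : realType) (X Y : R) : R :=
  3 * repulsion (3 * X ^+ 2 + Y ^+ 2) * X.

Definition accY (R : realType) (X Y : R) : R :=
  repulsion (3 * X ^+ 2 + Y ^+ 2) * Y + 2 * repulsion (4 * Y ^+ 2) * Y.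

(** Normal coordinates around the equilateral triangle [X = Y = 1 / 2]: [u] is
    the homothetic mode and [v] the mode keeping, to first order, the area. *)
Definition nonlinU (R : realType) (u v : R) : R :=
  (accX (1 / 2 + (u + v)) (1 / 2 + (u - v))
   + accY (1 / 2 + (u + v)) (1 / 2 + (u - v))) / 2 + 216 * u.

Definition nonlinV (R : realType) (u v : R) : R :=
  (accX (1 / 2 + (u + v)) (1 / 2 + (u - v))
   - accY (1 / 2 + (u + v)) (1 / 2 + (u - v))) / 2 + 108 * v.

Section nonlinearity.
Context {R : realType}.
Let V : normedModType R := (R * R)%type.

Lemma pair_affine (c a b : R) :
  strict_diff (fun z : V => c + (a * z.1 + b * z.2)) (fun z => a * z.1 + b * z.2).
Proof.
apply: (@strict_diff_affine R V c (fun z => a * z.1 + b * z.2)).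
  exists (`|a| + `|b| + 1) => [|v]; first by rewrite ltr_wpDl// addr_ge0.
  have v1 : `|v.1| <= `|v| by rewrite prod_normE/= le_max lexx.
  have v2 : `|v.2| <= `|v| by rewrite prod_normE/= le_max lexx orbT.
  rewrite mulrDl mul1r; apply: le_trans (ler_normD _ _) _; rewrite ler_wpDr//.
  by rewrite mulrDl !normrM lerD// ler_wpM2l.
by move=> x y /=; ring.
Qed.

Lemma strict_diff_repulsion (D l : V -> R) : strict_diff D l -> D 0 = 1 ->
  strict_diff (fun z => repulsion (D z)) (fun v => - 36 * l v).
Proof.
move=> SD D1; have SV := strict_diffV SD D1.
have V1 : (D 0)^-1 = 1 by rewrite D1 invr1.
have S7 := strict_diffX1 7 SV V1; have S4 := strict_diffX1 4 SV V1.
apply: strict_diff_eq (strict_diffM (strict_diff_cst 12)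
  (strict_diffD S7 (strict_diffM (strict_diff_cst (- 1)) S4))) _ _ => v /=.
  by rewrite mulN1r.
by ring.
Qed.

Let X (z : V) : R := 1 / 2 + (z.1 + z.2).
Let Y (z : V) : R := 1 / 2 + (z.1 - z.2).

Let SX : strict_diff X (fun v => v.1 + v.2).
Proof.
by apply: strict_diff_eq (pair_affine (1 / 2) 1 1) _ _ => v; rewrite /X; ring.
Qed.

Let SY : strict_diff Y (fun v => v.1 - v.2).
Proof.
by apply: strict_diff_eq (pair_affine (1 / 2) 1 (- 1)) _ _ => v;
  rewrite /Y; ring.
Qed.

Let X0 : X 0 = 1 / 2. Proof. by rewrite /X /= !addr0. Qed.
Let Y0 : Y 0 = 1 / 2. Proof. by rewrite /Y /= subr0 addr0. Qed.

Let SX2 := strict_diffM SX SX.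
Let SY2 := strict_diffM SY SY.

Let P1 : strict_diff (fun z => repulsion (3 * X z ^+ 2 + Y z ^+ 2))
  (fun v => - 36 * (4 * v.1 + 2 * v.2)).
Proof.
apply: strict_diff_eq (strict_diff_repulsion
  (strict_diffD (strict_diffM (strict_diff_cst 3) SX2) SY2) _) _ _ => [|//|v].
  by rewrite X0 Y0; field.
by rewrite X0 Y0; field.
Qed.

Let P2 : strict_diff (fun z => repulsion (4 * Y z ^+ 2))
  (fun v => - 36 * (4 * (v.1 - v.2))).
Proof.
apply: strict_diff_eq (strict_diff_repulsion
  (strict_diffM (strict_diff_cst 4) SY2) _) _ _ => [|//|v].
  by rewrite Y0; field.
by rewrite Y0; field.
Qed.

Lemma repulsion1 : repulsion (1 : R) = 0.
Proof. by rewrite /repulsion invr1 !expr1n subrr mulr0. Qed.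

Let D1 : 3 * X 0 ^+ 2 + Y 0 ^+ 2 = 1. Proof. by rewrite X0 Y0; field. Qed.
Let D2 : 4 * Y 0 ^+ 2 = 1. Proof. by rewrite Y0; field. Qed.

Let SaccX : strict_diff (fun z => accX (X z) (Y z))
  (fun v => - 108 * (2 * v.1 + v.2)).
Proof.
apply: strict_diff_eq (strict_diffM (strict_diffM (strict_diff_cst 3) P1) SX)
  _ _ => // v.
by rewrite D1 repulsion1 X0; field.
Qed.

Let SaccY : strict_diff (fun z => accY (X z) (Y z))
  (fun v => - 108 * (2 * v.1 - v.2)).
Proof.
apply: strict_diff_eq (strict_diffD (strict_diffM P1 SY)
  (strict_diffM (strict_diffM (strict_diff_cst 2) P2) SY)) _ _ => // v.
by rewrite D1 D2 repulsion1 Y0; field.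
Qed.

Let acc0 : accX (X 0) (Y 0) = 0 /\ accY (X 0) (Y 0) = 0.
Proof. by rewrite /accX /accY D1 D2 repulsion1 !mulr0 !mul0r addr0. Qed.

Lemma nonlinU_small : strictly_small (@nonlinU R).
Proof.
have [aX aY] := acc0.
apply: (@strict_diff_small _ (fun z => nonlinU z.1 z.2)).
  rewrite -[LHS]/((accX (X 0) (Y 0) + accY (X 0) (Y 0)) / 2 + 216 * 0) aX aY.
  by rewrite addr0 mul0r mulr0 addr0.
apply: strict_diff_eq (strict_diffD (strict_diffM (strict_diffD SaccX SaccY)
  (strict_diff_cst (2^-1))) (pair_affine 0 216 0)) _ _ => v.
  by rewrite add0r mul0r addr0.
by rewrite aX aY; field.
Qed.

Lemma nonlinV_small : strictly_small (@nonlinV R).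
Proof.
have [aX aY] := acc0.
apply: (@strict_diff_small _ (fun z => nonlinV z.1 z.2)).
  rewrite -[LHS]/((accX (X 0) (Y 0) - accY (X 0) (Y 0)) / 2 + 108 * 0) aX aY.
  by rewrite subr0 mul0r mulr0 addr0.
apply: strict_diff_eq (strict_diffD (strict_diffM (strict_diffD SaccX
  (strict_diffM (strict_diff_cst (- 1)) SaccY))
  (strict_diff_cst (2^-1))) (pair_affine 0 0 108)) _ _ => v.
  by rewrite add0r mul0r add0r mulN1r.
by rewrite aX aY; field.
Qed.
End nonlinearity.

Lemma strictly_small_swap (R : realType) (n : R -> R -> R) :
  strictly_small n -> strictly_small (fun u v => n v u).
Proof.
by move=> ns eta /ns[r r0 [n0 nl]]; exists r => //; split=> // *; exact: nl.
Qed.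

(** * Periodic motions of the reduced system *)

Lemma sin_mul_pi_neq0 (R : realType) (x : R) :
  0 < x < 2 -> x != 1 -> sin (x * pi) != 0.
Proof.
move=> /andP[x0 x2] x1; have pi0 := pi_gt0 R.
have [lt1|ge1] := ltP x 1.
  by apply/lt0r_neq0/sin_gt0_pi; rewrite mulr_gt0//= gtr_pMl.
have {x1 ge1} gt1 : 1 < x by rewrite lt_neqAle eq_sym x1.
rewrite -[x * pi](subrK pi) sinDpi oppr_eq0; apply/lt0r_neq0/sin_gt0_pi.
have -> : x * pi - pi = (x - 1) * pi by rewrite mulrBl mul1r.
by rewrite mulr_gt0 ?subr_gt0//= gtr_pMl//; lra.
Qed.

Lemma sqrt2_bounds (R : realType) : 1 < Num.sqrt (2 : R) < 2.
Proof.
have s0 : 0 <= Num.sqrt (2 : R) := sqrtr_ge0 _.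
have s2 : Num.sqrt (2 : R) ^+ 2 = 2 by rewrite sqr_sqrtr.
by apply/andP; split; rewrite ltNge; apply/negP => h; move: s2; nra.
Qed.

(** The frequencies are [sqrt 108] and [sqrt 216]; their ratio [sqrt 2] and its
    inverse both lie strictly between 0 and 2 and differ from 1, so neither
    frequency is a multiple of the other and each mode, in turn, can play the
    resonant part in [brake_orbits]. *)
Lemma normal_mode_motion (R : realType) (T0 delta : R) :
  T0 = pi / (3 * Num.sqrt 3) \/ T0 = pi / (3 * Num.sqrt 6) -> 0 < delta ->
  exists (u u' v v' : R -> R) (T : R),
  [/\ (forall t : R, is_derive t 1 u (u' t) /\
        is_derive t 1 u' (nonlinU (u t) (v t) - 216 * u t)),
      (forall t : R, is_derive t 1 v (v' t) /\
        is_derive t 1 v' (nonlinV (u t) (v t) - 108 * v t)),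
      (forall t, `|u t| <= delta /\ `|v t| <= delta),
      (forall t, u (t + T) = u t /\ v (t + T) = v t) &
      [/\ 0 < T, `|T - T0| < delta, ~ (u 0 = u (T / 2) /\ v 0 = v (T / 2)) &
      forall S : R, 0 < S -> (forall t, u (t + S) = u t /\ v (t + S) = v t) ->
        T <= S]].
Proof.
move=> hT0 delta0; have /andP[s1 s2] := sqrt2_bounds R.
have s0 : 0 < Num.sqrt (2 : R) by apply: lt_trans s1.
have c0 : 0 < Num.sqrt (108 : R) by rewrite sqrtr_gt0.
have sqrt216 : Num.sqrt (216 : R) = Num.sqrt 108 * Num.sqrt 2.
  by rewrite -sqrtrM//; congr Num.sqrt; ring.
have sqrt36 (x : R) : Num.sqrt (36 * x) = 6 * Num.sqrt x.
  rewrite sqrtrM// (_ : 36 = 6 ^+ 2 :> R); last by ring.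
  by rewrite sqrtr_sqr ger0_norm.
case: hT0 => ->.
- have sin1 : sin (Num.sqrt (216 : R) / Num.sqrt 108 * pi) != 0.
    rewrite sqrt216 [Num.sqrt 108 * _]mulrC (mulfK (lt0r_neq0 c0)).
    by apply: sin_mul_pi_neq0; [rewrite s0|rewrite gt_eqF].
  have [u [u' [v [v' [T [du dv uv uvT [T_gt0 TT0 v0T minT]]]]]]] :=
    @brake_orbits R 216 108 _ _ delta ltac:(lra) ltac:(lra) sin1
      (@nonlinU_small R) (@nonlinV_small R) delta0.
  exists u, u', v, v', T; split=> //; split=> //.
  + rewrite (_ : pi / (3 * Num.sqrt 3) = 2 * pi / Num.sqrt 108)//.
    rewrite (_ : 108 = 36 * 3 :> R); last by ring.
    rewrite sqrt36; have : Num.sqrt (3 : R) != 0 by rewrite lt0r_neq0// sqrtr_gt0.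
    by move: (pi : R) (Num.sqrt 3) => p s s3; field.
  + by move=> [_ /eqP]; exact/negP.
  + by move=> S S0 per; apply: minT => // t; case: (per t).
- have sin2 : sin (Num.sqrt (108 : R) / Num.sqrt 216 * pi) != 0.
    rewrite sqrt216 invfM mulrA (divff (lt0r_neq0 c0)) mul1r.
    apply: sin_mul_pi_neq0; last by rewrite invr_eq1 gt_eqF.
    by rewrite invr_gt0 s0/= (lt_trans (y := 1))// ?ltr1n// invf_lt1.
  have [v [v' [u [u' [T [dv du vu vuT [T_gt0 TT0 u0T minT]]]]]]] :=
    @brake_orbits R 108 216 _ _ delta ltac:(lra) ltac:(lra) sin2
      (strictly_small_swap (@nonlinV_small R))
      (strictly_small_swap (@nonlinU_small R)) delta0.
  exists u, u', v, v', T; split=> //; last split=> //.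
  + by move=> t; case: (vu t).
  + by move=> t; case: (vuT t).
  + rewrite (_ : pi / (3 * Num.sqrt 6) = 2 * pi / Num.sqrt 216)//.
    rewrite (_ : 216 = 36 * 6 :> R); last by ring.
    rewrite sqrt36; have : Num.sqrt (6 : R) != 0 by rewrite lt0r_neq0// sqrtr_gt0.
    by move: (pi : R) (Num.sqrt 6) => p s s3; field.
  + by move=> [/eqP + _]; exact/negP.
  + by move=> S S0 per; apply: minT => // t; case: (per t).
Qed.

Lemma isosceles_motion (R : realType) (T0 delta : R) :
  T0 = pi / (3 * Num.sqrt 3) \/ T0 = pi / (3 * Num.sqrt 6) -> 0 < delta ->
  exists (X X' Y Y' : R -> R) (T : R),
  [/\ (forall t : R, is_derive t 1 X (X' t) /\
        is_derive t 1 X' (accX (X t) (Y t))),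
      (forall t : R, is_derive t 1 Y (Y' t) /\
        is_derive t 1 Y' (accY (X t) (Y t))),
      (forall t, `|X t - 1 / 2| <= delta /\ `|Y t - 1 / 2| <= delta),
      (forall t, X (t + T) = X t /\ Y (t + T) = Y t) &
      [/\ 0 < T, `|T - T0| < delta, ~ (X 0 = X (T / 2) /\ Y 0 = Y (T / 2)) &
      forall S : R, 0 < S -> (forall t, X (t + S) = X t /\ Y (t + S) = Y t) ->
        T <= S]].
Proof.
move=> hT0 delta0; have delta2 : 0 < delta / 2 by rewrite divr_gt0.
have [u [u' [v [v' [T [du dv uv uvT [T_gt0 TT0 uv0 minT]]]]]]] :=
  normal_mode_motion hT0 delta2.
exists (fun t => 1 / 2 + (u t + v t)), (fun t => u' t + v' t).
exists (fun t => 1 / 2 + (u t - v t)), (fun t => u' t - v' t), T; split.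
- move=> t; have [? ?] := du t; have [? ?] := dv t.
  split; apply: is_derive_eq; first by rewrite /cst; ring.
  by rewrite /nonlinU /nonlinV; field.
- move=> t; have [? ?] := du t; have [? ?] := dv t.
  split; apply: is_derive_eq; first by rewrite /cst; ring.
  by rewrite /nonlinU /nonlinV; field.
- move=> t; have [/ler_normlP[? ?] /ler_normlP[? ?]] := uv t.
  by split; apply/ler_normlP; split; lra.
- by move=> t; have [-> ->] := uvT t.
- have sep a b : 1 / 2 + (u a + v a) = 1 / 2 + (u b + v b) /\
    1 / 2 + (u a - v a) = 1 / 2 + (u b - v b) -> u a = u b /\ v a = v b.
    by move=> [? ?]; split; lra.
  split=> //; first by apply: lt_trans TT0 _; lra.
    by move/sep.
  by move=> S S0 per; apply: minT => // t; exact/sep/per.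
Qed.

(** * The Lennard-Jones force on isosceles triangles *)

Lemma is_derive_mx (R : realType) (m n : nat) (M : R -> 'M[R]_(m, n))
    (N : 'M[R]_(m, n)) (t : R) :
  (forall i j, is_derive t 1 (fun s => M s i j) (N i j)) -> is_derive t 1 M N.
Proof.
move=> dM; have Md : derivable M t 1.
  by apply/derivable_mxP => i j; case: (dM i j).
apply: DeriveDef => //; rewrite derive_mx//; apply/matrixP => i j.
by rewrite mxE; case: (dM i j).
Qed.

Lemma derive_along (R : realType) (V : normedModType R)
    (f : V -> R) (x v : V) (d : R) :
  is_derive (0 : R) 1 (fun h : R => f (h *: v + x)) d -> 'D_v f x = d.
Proof.
move=> [_ <-]; rewrite /derive /= scale0r add0r.
by under [in RHS]eq_fun do rewrite [_ *: 1]mulr1 addr0.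
Qed.
Definition pair_energy (R : realType) (D : R) : R := D^-1 ^+ 6 - 2 * D^-1 ^+ 3.

Lemma pair_energy_derive (R : realType) (D : R -> R) (t dD : R) :
  D t != 0 -> is_derive t 1 D dD ->
  is_derive t 1 (fun s => pair_energy (D s)) (- (repulsion (D t) / 2) * dD).
Proof.
move=> D0 dD'; have ? := is_deriveV D0 dD'.
apply: is_derive_eq; rewrite /GRing.scale/= /repulsion; field.
exact: D0.
Qed.

Section potential.
Context {R : realType}.
Implicit Types q v : 'rV[R]_6.

Definition coordinate q (n : nat) : R := q ord0 (inord n).

Definition dist2 (i j : nat) q : R :=
  (coordinate q (2 * i) - coordinate q (2 * j)) ^+ 2
  + (coordinate q (2 * i).+1 - coordinate q (2 * j).+1) ^+ 2.

Lemma enorm_particle q (i j : 'I_3) :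
  enorm (particle i q - particle j q) ^+ 2 = dist2 i j q.
Proof.
rewrite /enorm sqr_sqrtr; last by apply: sumr_ge0 => k _; exact: sqr_ge0.
by rewrite !big_ord_recl big_ord0 !mxE /= !addn0 !addn1 addr0.
Qed.

Lemma lennard_jonesE q : lennard_jones q = pair_energy (dist2 0 1 q) +
  pair_energy (dist2 0 2 q) + pair_energy (dist2 1 2 q).
Proof.
have pairE (i j : 'I_3) : 1 / enorm (particle i q - particle j q) ^+ 12 -
    2 / enorm (particle i q - particle j q) ^+ 6 = pair_energy (dist2 i j q).
  rewrite /pair_energy -enorm_particle.
  by rewrite !exprVn -!exprM mul1r.
rewrite /lennard_jones; under eq_bigr do under eq_bigr do rewrite pairE.
under eq_bigr do rewrite big_mkcond /=.
by rewrite !big_ord_recl !big_ord0 /= !addr0 !add0r addrA.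
Qed.

Lemma derive_lennard_jones q v :
  dist2 0 1 q != 0 -> dist2 0 2 q != 0 -> dist2 1 2 q != 0 ->
  'D_v (@lennard_jones R) q =
  - \sum_(ij <- [:: (0, 1); (0, 2); (1, 2)]%N) repulsion (dist2 ij.1 ij.2 q) *
    ((coordinate q (2 * ij.1) - coordinate q (2 * ij.2)) *
       (coordinate v (2 * ij.1) - coordinate v (2 * ij.2)) +
     (coordinate q (2 * ij.1).+1 - coordinate q (2 * ij.2).+1) *
       (coordinate v (2 * ij.1).+1 - coordinate v (2 * ij.2).+1)).
Proof.
move=> d01 d02 d12; apply: derive_along.
have pd i j : dist2 i j q != 0 -> is_derive (0 : R) 1
  (fun h : R => pair_energy (dist2 i j (h *: v + q)))
  (- (repulsion (dist2 i j q)) *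
    ((coordinate q (2 * i) - coordinate q (2 * j)) *
       (coordinate v (2 * i) - coordinate v (2 * j)) +
     (coordinate q (2 * i).+1 - coordinate q (2 * j).+1) *
       (coordinate v (2 * i).+1 - coordinate v (2 * j).+1))).
  move=> dij; have q0 : dist2 i j (0 *: v + q) = dist2 i j q.
    by rewrite scale0r add0r.
  pose D (h : R) := (h * (coordinate v (2 * i) - coordinate v (2 * j)) +
      (coordinate q (2 * i) - coordinate q (2 * j))) ^+ 2 +
    (h * (coordinate v (2 * i).+1 - coordinate v (2 * j).+1) +
      (coordinate q (2 * i).+1 - coordinate q (2 * j).+1)) ^+ 2.
  have DE h : dist2 i j (h *: v + q) = D h.
    by rewrite /dist2 /coordinate !mxE /D /coordinate; ring.
  under eq_fun do rewrite DE.
  have D0 : D 0 != 0 by rewrite -DE q0.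
  have dD : is_derive (0 : R) 1 D (2 * (
    (coordinate q (2 * i) - coordinate q (2 * j)) *
       (coordinate v (2 * i) - coordinate v (2 * j)) +
     (coordinate q (2 * i).+1 - coordinate q (2 * j).+1) *
       (coordinate v (2 * i).+1 - coordinate v (2 * j).+1))).
    by apply: is_derive_eq; rewrite /GRing.scale/=; ring.
  have := pair_energy_derive D0 dD; rewrite -DE q0 => h; apply: is_derive_eq.
  by field.
have -> : (fun h : R => lennard_jones (h *: v + q)) = (fun h : R =>
   pair_energy (dist2 0 1 (h *: v + q)) + pair_energy (dist2 0 2 (h *: v + q))
   + pair_energy (dist2 1 2 (h *: v + q))).
  by apply/funext => h; exact: lennard_jonesE.
have ? := pd _ _ d01; have ? := pd _ _ d02; have ? := pd _ _ d12.
apply: is_derive_eq; rewrite !big_cons big_nil /=.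
by ring.
Qed.

(** Equilateral with side 1 when [X = 1 / 2] and [Y] is [1 / 2] or [- 1 / 2]; the
    two signs give the two orientations. *)
Definition isosceles (X Y : R) : 'rV[R]_6 :=
  let s := (Num.sqrt 3)^-1 in
  \row_(k < 6) [:: 2 * s * X; 0; - s * X; Y; - s * X; - Y]`_k.

Lemma coord_isosceles X Y n : (n < 6)%N -> coordinate (isosceles X Y) n =
  let s := (Num.sqrt 3)^-1 in [:: 2 * s * X; 0; - s * X; Y; - s * X; - Y]`_n.
Proof. by move=> n6; rewrite /coordinate mxE inordK. Qed.

Lemma sqr_invsqrt3 : (Num.sqrt (3 : R))^-1 ^+ 2 = 1 / 3.
Proof. by rewrite exprVn sqr_sqrtr// mul1r. Qed.

Lemma dist2_isosceles X Y :
  [/\ dist2 0 1 (isosceles X Y) = 3 * X ^+ 2 + Y ^+ 2,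
      dist2 0 2 (isosceles X Y) = 3 * X ^+ 2 + Y ^+ 2 &
      dist2 1 2 (isosceles X Y) = 4 * Y ^+ 2].
Proof.
have s2 := sqr_invsqrt3; rewrite /dist2 !coord_isosceles//=.
move: (_^-1) s2 => s s2.
have -> : 3 * X ^+ 2 = 9 * s ^+ 2 * X ^+ 2 by rewrite s2; field.
by split; ring.
Qed.

(** Isosceles triangles are invariant: by symmetry the force on such a triangle
    is again of the form [isosceles]. *)
Lemma gradient_isosceles X Y : 3 * X ^+ 2 + Y ^+ 2 != 0 -> Y != 0 ->
  - gradient (@lennard_jones R) (isosceles X Y) =
    isosceles (accX X Y) (accY X Y).
Proof.
move=> D0 Y0; have [d01 d02 d12] := dist2_isosceles X Y.
have coord_delta n (k : 'I_6) : (n < 6)%N ->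
    coordinate (delta_mx ord0 k) n = (n == k)%:R :> R.
  by move=> n6; rewrite /coordinate mxE eqxx /= -val_eqE /= inordK.
apply/rowP => k; rewrite !mxE derive_lennard_jones ?d01 ?d02 ?d12//; last first.
  by rewrite mulf_neq0 ?pnatr_eq0 ?sqrf_eq0.
rewrite opprK !big_cons big_nil /= !coord_isosceles// !coord_delta// d01 d02 d12.
rewrite /accX /accY.
by case: k => [[|[|[|[|[|[|//]]]]]] k6] /=; ring.
Qed.

End potential.

(** * Motions near the equilateral triangles *)

Section equilateral.
Context {R : realType}.

Lemma isosceles_derive (X Y : R -> R) (t dX dY : R) :
  is_derive t 1 X dX -> is_derive t 1 Y dY ->
  is_derive t 1 (fun s => isosceles (X s) (Y s)) (isosceles dX dY).
Proof.
move=> X' Y'; apply: is_derive_mx => i k; rewrite mxE.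
under eq_fun do rewrite mxE.
by case: k => [[|[|[|[|[|[|//]]]]]] k6] /=; apply: is_derive_eq;
  rewrite /GRing.scale/=; ring.
Qed.

Lemma isosceles_newton (X X' Y Y' : R -> R) :
  (forall t : R, is_derive t 1 X (X' t) /\
    is_derive t 1 X' (accX (X t) (Y t))) ->
  (forall t : R, is_derive t 1 Y (Y' t) /\
    is_derive t 1 Y' (accY (X t) (Y t))) ->
  (forall t, 3 * X t ^+ 2 + Y t ^+ 2 != 0 /\ Y t != 0) ->
  (forall t, Omega (isosceles (X t) (Y t))) ->
  newton_solution (fun t => isosceles (X t) (Y t)).
Proof.
move=> dX dY nz om; pose q t := isosceles (X t) (Y t).
have q1 (t : R) : is_derive t 1 q (isosceles (X' t) (Y' t)).
  by apply: isosceles_derive; [case: (dX t)|case: (dY t)].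
have q2 (t : R) : is_derive t 1 (fun t => isosceles (X' t) (Y' t))
    (isosceles (accX (X t) (Y t)) (accY (X t) (Y t))).
  by apply: isosceles_derive; [case: (dX t)|case: (dY t)].
have dq : derive1 q = fun t => isosceles (X' t) (Y' t).
  by apply/funext => t; rewrite derive1E; case: (q1 t).
move=> t; have [D0 Y0] := nz t; split.
- exact: om.
- by case: (q1 t).
- by rewrite dq; case: (q2 t).
- by rewrite dq derive1E gradient_isosceles//; case: (q2 t).
Qed.

Lemma accX_oppY (X Y : R) : accX X (- Y) = accX X Y.
Proof. by rewrite /accX sqrrN. Qed.

Lemma accY_oppY (X Y : R) : accY X (- Y) = - accY X Y.
Proof. by rewrite /accY sqrrN; ring. Qed.

Lemma cos_sin_2pi3 : cos (2 * pi / 3) = - (1 / 2) :> R /\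
  sin (2 * pi / 3) = Num.sqrt 3 / 2 :> R.
Proof.
have pi0 := pi_gt0 R; pose x : R := pi / 3.
have sx : 0 < sin x by apply: sin_gt0_pi; rewrite /x; apply/andP; split; lra.
have sin2x : sin (x *+ 2) = sin x.
  have -> : x *+ 2 = pi - x by rewrite /x; field.
  by rewrite sinB sinpi cospi; ring.
have cx : cos x = 1 / 2.
  move: sin2x; rewrite sin_mulr2n => h.
  apply: (mulIf (lt0r_neq0 sx)); lra.
have -> : 2 * pi / 3 = x *+ 2 by rewrite /x; field.
rewrite sin2x cos_mulr2n cx; split; first by field.
rewrite -[LHS]gtr0_norm// -sqrtr_sqr sin2cos2 cx.
have -> : 1 - (1 / 2) ^+ 2 = 3 / 2 ^+ 2 :> R by field.
by rewrite sqrtrM// sqrtrV// sqrtr_sqr ger0_norm.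
Qed.

Lemma cos_sin_4pi3 : cos (4 * pi / 3) = - (1 / 2) :> R /\
  sin (4 * pi / 3) = - (Num.sqrt 3 / 2) :> R.
Proof.
have -> : 4 * pi / 3 = - (2 * pi / 3) + pi *+ 2 :> R by field.
by rewrite cosD2pi sinD2pi cosN sinN; have [-> ->] := cos_sin_2pi3.
Qed.

Lemma q0_isosceles :
  q04 R = isosceles (1 / 2) (1 / 2) /\ q05 R = isosceles (1 / 2) (- (1 / 2)).
Proof.
have s0 : Num.sqrt (3 : R) != 0 by rewrite lt0r_neq0// sqrtr_gt0.
have [ca sa] := cos_sin_2pi3; have [cb sb] := cos_sin_4pi3.
split; apply/rowP => k; rewrite !mxE ca sa cb sb;
  case: k => [[|[|[|[|[|[|//]]]]]] k6] /=; by field.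
Qed.

Lemma SO2_orbit_refl (p : 'rV[R]_6) : SO2_orbit p p.
Proof.
exists 1%:M; first by split; [rewrite trmx1 mulmx1|rewrite det1].
apply/rowP => k; rewrite mxE mul1mx !mxE; congr (p _ _).
apply: val_inj => /=.
have k2 : (k %/ 2 < 3)%N by rewrite ltn_divLR// ltn_ord.
by rewrite !inordK ?ltn_pmod// ?inordK// mulnC -divn_eq ?ltn_ord.
Qed.

Lemma isosceles_ball (X Y X0 Y0 e : R) : `|X - X0| < e -> `|Y - Y0| < e ->
  ball (isosceles X0 Y0) (2 * e) (isosceles X Y).
Proof.
move=> Xe Ye; have e0 : 0 < e by exact: le_lt_trans Xe.
split=> [|i k]; first by rewrite mulr_gt0.
rewrite /ball /= !mxE.
have s0 : 0 <= (Num.sqrt (3 : R))^-1 by rewrite invr_ge0 sqrtr_ge0.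
have s1 : (Num.sqrt (3 : R))^-1 <= 1.
  have := @sqr_invsqrt3 R; move: s0; move: (_^-1) => s; nra.
have sX : `|(Num.sqrt 3)^-1 * (X0 - X)| < e.
  rewrite normrM ger0_norm// distrC.
  by apply: le_lt_trans Xe; rewrite ler_piMl.
move/ltr_normlP : sX => [sX1 sX2]; move/ltr_normlP : Ye => [Ye1 Ye2].
by case: k => [[|[|[|[|[|[|//]]]]]] k6] /=; apply/ltr_normlP; split; lra.
Qed.

(** The sign [sg] selects the orientation of the triangle; reflecting a motion of
    isosceles triangles at the first axis changes the sign of [Y] only. *)
Lemma equilateral_motion (sg T0 : R) (V : set 'rV[R]_6) (delta : R) :
  sg = 1 \/ sg = - 1 ->
  T0 = pi / (3 * Num.sqrt 3) \/ T0 = pi / (3 * Num.sqrt 6) ->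
  open V -> V `<=` @Omega R -> V (isosceles (1 / 2) (sg * (1 / 2))) ->
  0 < delta ->
  exists (q : R -> 'rV[R]_6) (T : R),
    [/\ newton_solution q, non_stationary q, minimal_period q T,
        (forall t : R, V (q t)) & `|T - T0| < delta].
Proof.
move=> hsg hT0 Vo VO Vp delta0.
have sg2 : sg * sg = 1 by case: hsg => ->; ring.
have [/= e e0 eV] : nbhs_ball (isosceles (1 / 2) (sg * (1 / 2))) V.
  by apply/nbhs_ballP/open_nbhs_nbhs.
pose d := Num.min delta (Num.min (e / 4) (1 / 4)).
have d0 : 0 < d by rewrite !lt_min delta0 !divr_gt0.
have [dd de d4] : [/\ d <= delta, d <= e / 4 & d <= 1 / 4].
  by split; rewrite !ge_min lexx ?orbT.
have [X [X' [Y [Y' [T [dX dY XY XYT [T_gt0 TT0 XY0 minT]]]]]]] :=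
  isosceles_motion hT0 d0.
pose q t := isosceles (X t) (sg * Y t).
have Vq t : V (q t).
  apply: eV; have [Xt Yt] := XY t.
  have -> : e = 2 * (e / 2) by field.
  apply: isosceles_ball; first by lra.
  have sg1 : `|sg| = 1 by case: hsg => ->; rewrite ?normrN normr1.
  by rewrite -mulrBr normrM sg1 [_ * `|_|]mul1r; lra.
have qinj s t : q s = q t -> X s = X t /\ Y s = Y t.
  move=> qst; have s0 : Num.sqrt (3 : R) != 0 by rewrite lt0r_neq0// sqrtr_gt0.
  have q0 := congr1 (fun w : 'rV[R]_6 => coordinate w 0) qst.
  have q3 := congr1 (fun w : 'rV[R]_6 => coordinate w 3) qst.
  rewrite /= !coord_isosceles//= in q0 q3; split.
    apply: mulfI q0; apply: mulf_neq0; first by rewrite pnatr_eq0.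
    by rewrite invr_neq0.
  by rewrite -[Y s]mul1r -[Y t]mul1r -sg2 -!mulrA q3.
have qper S : (forall t, q (t + S) = q t) <->
    (forall t, X (t + S) = X t /\ Y (t + S) = Y t).
  split=> h t; first exact: qinj.
  by have [x y] := h t; rewrite /q x y.
exists q, T; split=> //.
- apply: (@isosceles_newton X X' (fun t => sg * Y t) (fun t => sg * Y' t)).
  + move=> t; have [? h] := dX t; split=> //; apply: is_derive_eq.
    by case: hsg => ->; rewrite ?mul1r// mulN1r accX_oppY.
  + move=> t; have [? ?] := dY t; split; apply: is_derive_eq.
      by rewrite /GRing.scale/=; ring.
    rewrite /GRing.scale/=.
    by case: hsg => ->; rewrite ?mul1r ?mulN1r ?accY_oppY; ring.
  + move=> t; have [_ /ler_normlP[? ?]] := XY t; have Y0 : 0 < Y t by lra.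
    have sgY : sg * Y t != 0.
      apply: mulf_neq0; last exact: lt0r_neq0.
      by case: hsg => ->; rewrite ?oppr_eq0 oner_eq0.
    split=> //; apply: lt0r_neq0; have := sqr_ge0 (X t).
    have : 0 < (sg * Y t) ^+ 2 by rewrite exprn_even_gt0.
    by lra.
  + by move=> t; exact/VO/Vq.
- by move=> [c qc]; apply/XY0/qinj; rewrite !qc.
- split=> //; first by move=> t; move: t; apply/qper.
  by move=> S S0 Sper; apply: minT => //; apply/qper.
- exact: lt_le_trans TT0 dd.
Qed.
End equilateral.

Unset Implicit Arguments.

Theorem mainTheorem3 (R : realType) (p : 'rV[R]_6) (T0 : R)
    (hp : p = q04 R \/ p = q05 R)
    (hT0 : T0 = pi / (3 * Num.sqrt 3) \/ T0 = pi / (3 * Num.sqrt 6))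
    (V : set 'rV[R]_6) (hVo : open V) (hVO : V `<=` @Omega R)
    (hpV : SO2_orbit p `<=` V) (delta : R) (hdelta : 0 < delta) :
  exists (q : R -> 'rV[R]_6) (T : R),
    [/\ newton_solution q, non_stationary q, minimal_period q T,
        (forall t : R, V (q t)) & `|T - T0| < delta].
Proof.
have Vp : V p by exact/hpV/SO2_orbit_refl.
have [q04E q05E] := @q0_isosceles R.
case: hp Vp => -> Vp.
- apply: (@equilateral_motion R 1 T0 V delta) => //; first by left.
  by rewrite [1 * (1 / 2)]mul1r -q04E.
- apply: (@equilateral_motion R (- 1) T0 V delta) => //; first by right.
  by rewrite mulN1r -q05E.
Qed.
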